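(* Under the setting, assumptions and notation in the context, assume in addition that the parameter $\tau$ equals $\theta/2$ and that $\Gamma\ge\hat\Gamma_3$. Then there exist scalars $M>0$ and $B_F>0$ such that, with $$\Theta:=\max\Big\{1,\ \sigma_{R}\hat\gamma L_0\|v\|_{R},\ c_0L_0\big(\hat\gamma\|R\|_2\|v\|_2L_0+\sqrt{m}\,\Lambda_0+\mu_f c_0B_F/M\big)\Big\}\cdot\frac{\sqrt3\,M}{\mu_f},\qquad \mathscr{B}:=\max\Big\{(\Gamma+1)^{1-a-b}\|\Delta_1\|_2,\ \frac{4\Theta}{\mu_f\lambda\hat\gamma\theta}\Big\},$$ the iterates of the algorithm satisfy: (i) for every $k\ge1$, $\|\mathbf{x}_{k+1}-\mathbf{1}\bar x_{k+1}\|_{R}\le \dfrac{\mathscr{B}}{(k+\Gamma-1)^{1-a-b}}$; (ii) for every $k\ge1$, $\|\mathbf{y}_{k+1}-v\bar y_{k+1}\|_{C}\le \dfrac{\mathscr{B}}{(k+\Gamma-1)^{1-a-b}}$; (iii) $\lim_{k\to\infty}\bar x_k=x^*$.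
   Context: Problem data. Let $m,n\ge1$, $[m]=\{1,\dots,m\}$. For $i\in[m]$ let $f_i:\mathbb{R}^n\to\mathbb{R}$ be continuously differentiable and $F_i:\mathbb{R}^n\to\mathbb{R}^n$. Put $f=\sum_i f_i$, $F=\sum_iF_i$. Assume: $f$ is $\mu_f$-strongly convex ($\mu_f>0$); each $\nabla f_i$ is $L_f$-Lipschitz; $F$ is monotone ($(F(x)-F(y))^\top(x-y)\ge0$); each $F_i$ is $L_F$-Lipschitz ($L_f,L_F>0$). Let $\mathrm{SOL}(\mathbb{R}^n,F)=\{x: F(x)^\top(y-x)\ge0\ \forall y\in\mathbb{R}^n\}$, assumed nonempty, and let $x^*$ be the unique minimizer of $f$ over $\mathrm{SOL}(\mathbb{R}^n,F)$. For $\lambda>0$, $x^*_\lambda$ denotes the unique $x$ with $F(x)+\lambda\nabla f(x)=0$. Points of $\mathbb{R}^n$ are row vectors; $\mathbf{1}\in\mathbb{R}^m$ is the all-ones column vector; $\|\cdot\|_2$ is the Euclidean norm (Frobenius for non-square matrices, spectral norm for $m\times m$ matrices). Communication matrices. $R,C\in\mathbb{R}^{m\times m}$ are nonnegative with strictly positive diagonals, $R\mathbf{1}=\mathbf{1}$, $\mathbf{1}^\top C=\mathbf{1}^\top$. For nonnegative $B$, $\mathcal{G}_B$ is the digraph on $[m]$ with edge $(j,i)$ iff $B_{ij}>0$, and $\mathcal{R}_B$ is the set of vertices that are roots of some spanning tree of $\mathcal{G}_B$; assume $\mathcal{R}_R\cap\mathcal{R}_{C^\top}\neq\emptyset$. Let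 $u\ge0$ be the unique vector with $u^\top R=u^\top$, $u^\top\mathbf{1}=m$, and $v\ge0$ the unique vector with $Cv=v$, $\mathbf{1}^\top v=m$. Algorithm (IR-Push-Pull). With stepsizes $\gamma_{i,k}\ge0$ and $\lambda_k>0$: $x_{i,0}\in\mathbb{R}^n$ arbitrary, $y_{i,0}=F_i(x_{i,0})+\lambda_0\nabla f_i(x_{i,0})$, and for $k\ge0$: $x_{i,k+1}=\sum_jR_{ij}(x_{j,k}-\gamma_{j,k}y_{j,k})$, $y_{i,k+1}=\sum_jC_{ij}y_{j,k}+F_i(x_{i,k+1})+\lambda_{k+1}\nabla f_i(x_{i,k+1})-F_i(x_{i,k})-\lambda_k\nabla f_i(x_{i,k})$. $\mathbf{x}_k,\mathbf{y}_k\in\mathbb{R}^{m\times n}$ have rows $x_{i,k},y_{i,k}$; $\boldsymbol\gamma_k=\mathrm{diag}(\gamma_{1,k},\dots,\gamma_{m,k})$; $\bar x_k=\frac1m u^\top\mathbf{x}_k$, $\bar y_k=\frac1m\mathbf{1}^\top\mathbf{y}_k$. Parameters. $\hat\gamma_k:=\max_j\gamma_{j,k}=\hat\gamma/(k+\Gamma)^a$, $\lambda_k=\lambda/(k+\Gamma)^b$, with $\hat\gamma,\lambda,\Gamma,a,b>0$, $a>b$, $a+b<1$, $2a+3b<2$, $\Gamma\ge1$, $\Gamma\ge(4/(\hat\gamma\lambda\mu_f\tau))^{1/(1-a-b)}$ for a constant $\tau>0$; and $\alpha_k:=\frac1m u^\top\boldsymbol\gamma_kv\ge\theta\hat\gamma_k$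 for all $k\ge0$, for some $\theta>0$. $L_k:=L_F+\lambda_kL_f$, $\Lambda_k:=|1-\lambda_{k+1}/\lambda_k|$. Norms. For a vector norm $\|\cdot\|$ on $\mathbb{R}^m$, extend it to $W\in\mathbb{R}^{m\times p}$ by $\|W\|=\|(\|W_{\bullet1}\|,\dots,\|W_{\bullet p}\|)\|_2$ (columns $W_{\bullet j}$), and to square $m\times m$ matrices as the induced operator norm. Let $\|\cdot\|_R,\|\cdot\|_C$ be vector norms on $\mathbb{R}^m$ (so extended) with $\sigma_R:=\|R-\frac1m\mathbf{1}u^\top\|_R<1$, $\sigma_C:=\|C-\frac1m v\mathbf{1}^\top\|_C<1$, and $\|W\|_2\le\|W\|_R$, $\|W\|_2\le\|W\|_C$ for all $W$; let $\delta_{R,C},\delta_{C,2}>0$ satisfy $\|W\|_R\le\delta_{R,C}\|W\|_C$, $\|W\|_C\le\delta_{C,2}\|W\|_2$ for all $W$. $c_0:=\delta_{C,2}\|I-\frac1m v\mathbf{1}^\top\|_C$. Error vector. For $k\ge1$, $\Delta_k:=\big(\|\bar x_k-x^*_{\lambda_{k-1}}\|_2,\ \|\mathbf{x}_k-\mathbf{1}\bar x_k\|_R,\ \|\mathbf{y}_k-v\bar y_k\|_C\big)^\top$. Constants. $\bar\theta:=u^\top v/m$. $\hat\Gamma_2:=\max\{(L_0\hat\gamma u^\top v/m)^{1/a},\ (\hat\gamma u^\top vL_0^2/(m\mu_f\lambda))^{1/(a-b)}\}$. $c_1:=(0.5\mu_f\bar\theta\lambda)\sigma_R\delta_{R,C}c_0L_0\|R\|_2\|v\|_2\frac{L_0}{\sqrt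 m}+\frac{\bar\theta L_0}{\sqrt m}\sigma_R\delta_{R,C}c_0L_0\|R\|_2\|v\|_2L_0+\frac{\|u\|_2}{m}\sigma_RL_0\|v\|_R\,c_0L_0\|R\|_2\|v\|_2\frac{L_0}{\sqrt m}$; $c_2:=(0.5\mu_f\bar\theta\lambda)\sigma_R\delta_{R,C}c_0L_0(\|R-I\|_2+2\Lambda_0)+\frac{1-\sigma_C}{2}\frac{\bar\theta L_0}{\sqrt m}\sigma_RL_0\|v\|_R+\frac{\bar\theta L_0}{\sqrt m}\sigma_R\delta_{R,C}c_0L_0\,2\sqrt m\Lambda_0+\frac{\|u\|_2}{m}\sigma_RL_0\|v\|_R\,c_0L_0(\|R-I\|_2+2\Lambda_0)+\frac{1-\sigma_R}{2}c_0L_0\|R\|_2\|v\|_2L_0\frac{\|u\|_2}{m}$; $c_3:=\frac18\mu_f\theta(1-\sigma_R)(1-\sigma_C)$; $c_4:=\frac{1-\sigma_R}{2}c_0L_0\sqrt m\frac{\|u\|_2}{m}$. $\hat\Gamma_3:=\max\Big\{\hat\Gamma_2,\ \Big(\frac{\mu_f\lambda\hat\gamma u^\top v+2\hat\gamma\|v\|_RL_0}{(1-\sigma_R)\sqrt m}\Big)^{1/a},\ \Big(\frac{\mu_f\lambda\hat\gamma u^\top v+2\hat\gamma c_0L_0\|R\|_2}{1-\sigma_C}\Big)^{1/a},\ \Big(\frac{0.5\mu_f\lambda\hat\gamma u^\top v}{m}\Big)^{1/(a+b)},\ \Big(\frac{3c_1\hat\gamma^2}{c_3\lambda}\Big)^{1/(2a-b)},\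 \Big(\frac{3c_2\hat\gamma}{c_3\lambda}\Big)^{1/(a-b)},\ \Big(\frac{3c_4}{c_3\lambda}\Big)^{1/(1-b)}\Big\}$. *)

(* Defs.v *)
From HB Require Import structures.
From mathcomp Require Import all_boot all_order all_algebra.
From mathcomp Require Import all_classical all_reals all_analysis.
Set Implicit Arguments. Unset Strict Implicit. Unset Printing Implicit Defensive.
Import Order.TTheory GRing.Theory Num.Theory.
Import numFieldNormedType.Exports.
Local Open Scope classical_set_scope.
Local Open Scope ring_scope.

Section Defs.
Variable R : realType.

Definition enorm p q (W : 'M[R]_(p, q)) : R :=
  Num.sqrt (\sum_(i < p) \sum_(j < q) W i j ^+ 2).

Definition dotr n (x y : 'rV[R]_n) : R := (x *m y^T) 0 0.

Definition is_vnorm m (N : 'cV[R]_m -> R) : Prop :=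
  [/\ forall x, N x = 0 -> x = 0,
      forall (c : R) x, N (c *: x) = `|c| * N x
    & forall x y, N (x + y) <= N x + N y].

Definition mxnorm m p (N : 'cV[R]_m -> R) (W : 'M[R]_(m, p)) : R :=
  Num.sqrt (\sum_(j < p) (N (col j W)) ^+ 2).

Definition opnorm m (N : 'cV[R]_m -> R) (A : 'M[R]_m) : R :=
  sup [set N (A *m x) / N x | x in [set x : 'cV[R]_m | x != 0]].

Definition specnorm m (A : 'M[R]_m) : R := opnorm (@enorm m 1) A.

(* Root of a spanning tree of the digraph G_B (edge (j,i) iff B i j > 0):
   every vertex is reachable from r. *)
Definition spanning_root m (B : 'M[R]_m) (r : 'I_m) : bool :=
  [forall i, connect (fun j i => 0 < B i j) r i].

Definition is_C1_gradient n (f : 'rV[R]_n -> R) (g : 'rV[R]_n -> 'rV[R]_n) : Prop :=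
  (forall x, differentiable f x) /\
  (forall x h, 'd f x h = dotr (g x) h) /\ continuous g.

Definition strongly_convex_eucl n (mu : R) (f : 'rV[R]_n -> R) : Prop :=
  forall x y (t : R), 0 <= t <= 1 ->
    f (t *: x + (1 - t) *: y) <=
      t * f x + (1 - t) * f y - mu / 2 * t * (1 - t) * enorm (x - y) ^+ 2.

Definition lip_eucl n (L : R) (G : 'rV[R]_n -> 'rV[R]_n) : Prop :=
  forall x y, enorm (G x - G y) <= L * enorm (x - y).

Definition monotone_op n (G : 'rV[R]_n -> 'rV[R]_n) : Prop :=
  forall x y, 0 <= dotr (G x - G y) (x - y).

Definition SOL n (G : 'rV[R]_n -> 'rV[R]_n) : set 'rV[R]_n :=
  [set x | forall y, 0 <= dotr (G x) (y - x)].

End Defs.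

(* Main.v *)
Require Import Defs.
From HB Require Import structures.
From mathcomp Require Import all_boot all_order all_algebra.
From mathcomp Require Import all_classical all_reals all_analysis.
From mathcomp Require Import ring lra.
Import Order.TTheory GRing.Theory Num.Theory.
Import numFieldNormedType.Exports.
Local Open Scope classical_set_scope.
Local Open Scope ring_scope.

(* Since M is existential, the constant B can be made arbitrarily large, so only
   the order (k + Gamma)^-(1-a-b) of the errors matters. Write s = k + Gamma, and
   let e1, e2, e3 be the distance of the averaged iterate to the regularized
   solution x*_{lambda_k} and the two consensus errors. They satisfy
     e1' <= (1 - c gamma lambda) e1 + C gamma (e2 + e3) + C / s,
     e2' <= (1 - q) e2 + C gamma (e1 + e2 + e3),
     e3' <= (1 - q) e3 + C e2 + C gamma (e1 + e2 + e3) + (C / s) (1 + e1 + e2).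
   As gamma << lambda, the function e1 + gamma (A e2 + B e3) contracts at the rate
   gamma lambda ~ s^-(a+b) against a perturbation of order 1/s, whence
   e1 = O(s^-(1-a-b)); fed back into the last two inequalities this bounds
   A e2 + B e3 at the same order. The path lambda |-> x*_lambda is Cauchy as
   lambda decreases to 0 because f is monotone and bounded along it. *)

(** * Euclidean and mixed norms *)

(** The weighted sum controls e2 and e3 only after multiplication by the vanishing stepsize, so its
    decay bounds e1 alone; hence the second pass, which runs at a constant rate. The consensus
    recursions can involve gamma (e1 + e2 + e3) rather than a bare gamma because the tracked sum is
    compared with its value at x*_{lambda_k}, where it is zero. The additive C / s comes from the
    motion of lambda alone: it shifts the target, and it multiplies gradients of f, which need not
    vanish at the solution. Smallness conditions are required only eventually, since finitely many
    early indices can be absorbed into a constant. *)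

Lemma cauchy_schwarz_sum {R : realType} {I : finType} (a b : I -> R) :
  (\sum_i a i * b i) ^+ 2 <= (\sum_i a i ^+ 2) * (\sum_i b i ^+ 2).
Proof.
set A := \sum_i a i ^+ 2; set B := \sum_i b i ^+ 2; set P := \sum_i _ * _.
have A0 : 0 <= A by apply: sumr_ge0 => i _; exact: sqr_ge0.
(* The nonnegative sum of squares yields [P ^+ 2 <= A * B] after division by [A]; if [A = 0] then
   [a] vanishes. *)
have /eqP E : \sum_i (A * b i - P * a i) ^+ 2 == A * (A * B - P ^+ 2).
  apply/eqP; transitivity (\sum_i (A ^+ 2 * b i ^+ 2 - 2 * A * P * (a i * b i)
    + P ^+ 2 * a i ^+ 2)); first by apply: eq_bigr => i _; ring.
  by rewrite big_split/= sumrB -!mulr_sumr -/A -/B -/P; ring.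
have S0 : 0 <= A * (A * B - P ^+ 2).
  by rewrite -E; apply: sumr_ge0 => i _; exact: sqr_ge0.
have [Ap|] := ltP 0 A; first by rewrite pmulr_rge0// subr_ge0 in S0.
move=> Al; have A00 : A = 0 by apply/eqP; rewrite eq_le Al A0.
have a0 i : a i = 0.
  have /psumr_eq0P : forall i, true -> 0 <= a i ^+ 2 by move=> j _; exact: sqr_ge0.
  by move=> /(_ A00 i isT)/eqP; rewrite sqrf_eq0 => /eqP.
by rewrite /P big1 ?expr0n/= ?A00 ?mul0r// => i _; rewrite a0 mul0r.
Qed.

Section l2.
Context {R : realType} {I : finType}.
Implicit Types a b : I -> R.

(** The index type is arbitrary so that one triangle inequality serves both the Frobenius norm,
    indexed by pairs, and the mixed norm, indexed by columns. *)
Definition l2norm a : R := Num.sqrt (\sum_i a i ^+ 2).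

Lemma l2norm_ge0 a : 0 <= l2norm a. Proof. exact: sqrtr_ge0. Qed.

Lemma sqr_l2norm a : l2norm a ^+ 2 = \sum_i a i ^+ 2.
Proof. by rewrite sqr_sqrtr// sumr_ge0// => i _; exact: sqr_ge0. Qed.

Lemma l2norm_CS a b : \sum_i a i * b i <= l2norm a * l2norm b.
Proof.
apply: le_trans (ler_norm _) _.
rewrite -(@ler_pXn2r _ 2)// ?nnegrE ?mulr_ge0 ?l2norm_ge0//.
by rewrite exprMn !sqr_l2norm real_normK ?num_real// cauchy_schwarz_sum.
Qed.

Lemma l2norm_triangle a b : l2norm (fun i => a i + b i) <= l2norm a + l2norm b.
Proof.
rewrite -(@ler_pXn2r _ 2)// ?nnegrE ?addr_ge0 ?l2norm_ge0//.
rewrite sqr_l2norm sqrrD !sqr_l2norm.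
under eq_bigr do rewrite sqrrD.
by rewrite 2!big_split/= sumrMnl lerD2r lerD2l ler_pMn2r// l2norm_CS.
Qed.

Lemma l2norm_mono a b : (forall i, 0 <= a i <= b i) -> l2norm a <= l2norm b.
Proof.
move=> ab; apply: ler_wsqrtr; apply: ler_sum => i _.
by have /andP[a0 le] := ab i; rewrite ler_pXn2r// nnegrE (le_trans a0).
Qed.

Lemma l2normZ (c : R) a : l2norm (fun i => c * a i) = `|c| * l2norm a.
Proof.
rewrite /l2norm; under eq_bigr do rewrite exprMn.
by rewrite -mulr_sumr sqrtrM ?sqr_ge0// sqrtr_sqr.
Qed.

Lemma ler_l2norm a i : `|a i| <= l2norm a.
Proof.
rewrite -(@ler_pXn2r _ 2)// ?nnegrE ?l2norm_ge0// sqr_l2norm real_normK ?num_real//.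
by rewrite (bigD1 i)//= lerDl sumr_ge0// => j _; exact: sqr_ge0.
Qed.

End l2.

Section enorm_theory.
Context {R : realType}.

Lemma enormE {p q} (W : 'M[R]_(p, q)) :
  enorm W = l2norm (fun ij : 'I_p * 'I_q => W ij.1 ij.2).
Proof. by rewrite /enorm pair_bigA. Qed.

Lemma enorm_ge0 {p q} (W : 'M[R]_(p, q)) : 0 <= enorm W.
Proof. exact: sqrtr_ge0. Qed.

Lemma enormD {p q} (V W : 'M[R]_(p, q)) : enorm (V + W) <= enorm V + enorm W.
Proof.
rewrite !enormE; apply: le_trans (l2norm_triangle _ _).
by rewrite le_eqVlt; apply/orP; left; apply/eqP; congr l2norm; apply/funext => ij; rewrite mxE.
Qed.

Lemma enormZ {p q} (c : R) (W : 'M[R]_(p, q)) : enorm (c *: W) = `|c| * enorm W.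
Proof.
by rewrite !enormE -l2normZ; congr l2norm; apply/funext => ij; rewrite mxE.
Qed.

Lemma enormN {p q} (W : 'M[R]_(p, q)) : enorm (- W) = enorm W.
Proof. by rewrite -scaleN1r enormZ normrN1 mul1r. Qed.

Lemma enormB {p q} (V W : 'M[R]_(p, q)) : enorm (V - W) <= enorm V + enorm W.
Proof. by rewrite -(enormN W) enormD. Qed.

Lemma enorm_distC {p q} (V W : 'M[R]_(p, q)) : enorm (V - W) = enorm (W - V).
Proof. by rewrite -enormN opprB. Qed.

Lemma enorm0 {p q} : enorm (0 : 'M[R]_(p, q)) = 0.
Proof. by rewrite -(scale0r 0) enormZ normr0 mul0r. Qed.

Lemma ler_enorm {p q} (W : 'M[R]_(p, q)) i j : `|W i j| <= enorm W.
Proof. by rewrite enormE (ler_l2norm (fun ij => W ij.1 ij.2) (i, j)). Qed.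

Lemma enorm_eq0 {p q} (W : 'M[R]_(p, q)) : enorm W = 0 -> W = 0.
Proof.
move=> W0; apply/matrixP => i j; rewrite mxE; apply/eqP; rewrite -normr_le0 -W0.
exact: ler_enorm.
Qed.

Lemma sqr_enorm {p q} (W : 'M[R]_(p, q)) :
  enorm W ^+ 2 = \sum_i \sum_j W i j ^+ 2.
Proof. by rewrite enormE sqr_l2norm [RHS]pair_bigA. Qed.

(** Cauchy-Schwarz on each entry of the product. Through this bound the Frobenius norm replaces the
    spectral norm in all estimates of one step. *)
Lemma enorm_mulmx {p q r} (V : 'M[R]_(p, q)) (W : 'M[R]_(q, r)) :
  enorm (V *m W) <= enorm V * enorm W.
Proof.
rewrite -(@ler_pXn2r _ 2)// ?nnegrE ?mulr_ge0 ?enorm_ge0// exprMn !sqr_enorm.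
rewrite [X in _ <= _ * X]exchange_big mulr_suml; apply: ler_sum => i _.
rewrite mulr_sumr; apply: ler_sum => j _.
by rewrite mxE cauchy_schwarz_sum.
Qed.

Lemma sqr_enorm_rows {p q} (W : 'M[R]_(p, q)) :
  enorm W ^+ 2 = \sum_i enorm (row i W) ^+ 2.
Proof.
rewrite sqr_enorm; apply: eq_bigr => i _; rewrite sqr_enorm big_ord1.
by apply: eq_bigr => j _; rewrite mxE.
Qed.

Lemma enorm_rows_le {p q} (V W : 'M[R]_(p, q)) (c : R) : 0 <= c ->
  (forall i, enorm (row i V) <= c * enorm (row i W)) -> enorm V <= c * enorm W.
Proof.
move=> c0 VW; rewrite -(@ler_pXn2r _ 2)// ?nnegrE ?mulr_ge0 ?enorm_ge0//.
rewrite exprMn !sqr_enorm_rows mulr_sumr; apply: ler_sum => i _.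
by rewrite -exprMn ler_pXn2r// ?nnegrE ?mulr_ge0 ?enorm_ge0.
Qed.

Lemma dotrE {n} (x y : 'rV[R]_n) : dotr x y = \sum_j x 0 j * y 0 j.
Proof. by rewrite /dotr mxE; apply: eq_bigr => j _; rewrite mxE. Qed.

Lemma dotrC {n} (x y : 'rV[R]_n) : dotr x y = dotr y x.
Proof. by rewrite !dotrE; apply: eq_bigr => j _; rewrite mulrC. Qed.

Lemma dotrDl {n} (x y z : 'rV[R]_n) : dotr (x + y) z = dotr x z + dotr y z.
Proof. by rewrite /dotr mulmxDl mxE. Qed.

Lemma dotrZl {n} c (x z : 'rV[R]_n) : dotr (c *: x) z = c * dotr x z.
Proof. by rewrite /dotr -scalemxAl mxE. Qed.

Lemma dotrNl {n} (x z : 'rV[R]_n) : dotr (- x) z = - dotr x z.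
Proof. by rewrite -scaleN1r dotrZl mulN1r. Qed.

Lemma dotrDr {n} (x y z : 'rV[R]_n) : dotr z (x + y) = dotr z x + dotr z y.
Proof. by rewrite dotrC dotrDl !(dotrC _ z). Qed.

Lemma dotrZr {n} c (x z : 'rV[R]_n) : dotr z (c *: x) = c * dotr z x.
Proof. by rewrite dotrC dotrZl dotrC. Qed.

Lemma dotrNr {n} (x z : 'rV[R]_n) : dotr z (- x) = - dotr z x.
Proof. by rewrite dotrC dotrNl dotrC. Qed.

Definition dotr_lin := (@dotrDl, @dotrDr, @dotrNl, @dotrNr, @dotrZl, @dotrZr).

Lemma sqr_enorm_row {n} (x : 'rV[R]_n) : enorm x ^+ 2 = dotr x x.
Proof. by rewrite sqr_enorm big_ord1 dotrE; apply: eq_bigr => j _; rewrite expr2. Qed.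

Lemma dotr_CS {n} (x y : 'rV[R]_n) : dotr x y <= enorm x * enorm y.
Proof.
rewrite dotrE; apply: le_trans (l2norm_CS _ _) _.
by rewrite le_eqVlt; apply/orP; left; rewrite /enorm !big_ord1.
Qed.

End enorm_theory.

Section vnorm_theory.
Context {R : realType} {m : nat} (N : 'cV[R]_m -> R).
Hypothesis hN : is_vnorm N.

Lemma vnorm0 : N 0 = 0.
Proof. by case: hN => _ hZ _; rewrite -(scale0r 0) hZ normr0 mul0r. Qed.

Lemma vnorm_ge0 x : 0 <= N x.
Proof.
case: hN => _ hZ hD; have := hD x (- x).
rewrite subrr vnorm0 -scaleN1r hZ normrN1 mul1r; lra.
Qed.

Lemma mxnorm_l2 {p} (W : 'M[R]_(m, p)) : mxnorm N W = l2norm (fun j => N (col j W)).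
Proof. by []. Qed.

Lemma mxnorm_ge0 {p} (W : 'M[R]_(m, p)) : 0 <= mxnorm N W.
Proof. exact: sqrtr_ge0. Qed.

Lemma mxnormD {p} (V W : 'M[R]_(m, p)) : mxnorm N (V + W) <= mxnorm N V + mxnorm N W.
Proof.
rewrite !mxnorm_l2; apply: le_trans (l2norm_triangle _ _).
apply: l2norm_mono => j; rewrite vnorm_ge0/=.
by case: hN => _ _ hD; rewrite linearD hD.
Qed.

Lemma mxnorm_col (x : 'cV[R]_m) : mxnorm N x = N x.
Proof.
rewrite /mxnorm big_ord1 sqrtr_sqr ger0_norm ?vnorm_ge0//; congr N.
by apply/matrixP => i j; rewrite mxE [j]ord1.
Qed.

(** [opnorm] is a supremum, informative only if the quotients are bounded above; comparability with
    the Euclidean norm supplies the bound [K * enorm A]. *)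
Lemma opnorm_bound (K : R) (A : 'M[R]_m) (x : 'cV[R]_m) :
  (forall y, enorm y <= N y) -> (forall y, N y <= K * enorm y) ->
  N (A *m x) <= opnorm N A * N x.
Proof.
move=> le1 le2; have [->|x0] := eqVneq x 0; first by rewrite mulmx0 vnorm0 mulr0.
have Np (y : 'cV[R]_m) : y != 0 -> 0 < N y.
  move=> y0; rewrite lt_neqAle vnorm_ge0 andbT eq_sym; apply: contra_neq y0.
  by case: hN => h _ _ /h.
have K0 : 0 <= K.
  have e0 : 0 < enorm x.
    rewrite lt_neqAle enorm_ge0 andbT eq_sym; apply: contra_neq x0; exact: enorm_eq0.
  by have := le_trans (vnorm_ge0 x) (le2 x); rewrite pmulr_lge0.
rewrite -ler_pdivrMr ?Np//; apply: ub_le_sup; last by exists x.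
exists (K * enorm A) => _ /= [y y0 <-]; rewrite ler_pdivrMr ?Np//.
apply: le_trans (le2 _) _; rewrite -mulrA ler_wpM2l//.
apply: le_trans (enorm_mulmx _ _) _; rewrite ler_wpM2l// ?enorm_ge0//.
Qed.

Lemma mxnorm_mulmx (s : R) (A : 'M[R]_m) {p} (W : 'M[R]_(m, p)) : 0 <= s ->
  (forall x, N (A *m x) <= s * N x) -> mxnorm N (A *m W) <= s * mxnorm N W.
Proof.
move=> s0 le; rewrite !mxnorm_l2 -(ger0_norm s0) -l2normZ.
apply: l2norm_mono => j; rewrite vnorm_ge0/= colE -mulmxA -colE; exact: le.
Qed.

End vnorm_theory.

(** * Coupled recursive inequalities *)

Section recursions.
Context {R : realType}.

(** The finitely many early ratios [V i / w i] are added to the constant. *)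
Lemma bound_all_of_eventually (V w : nat -> R) (D : R) (K : nat) :
  (forall k, 0 < w k) -> (forall k, (K <= k)%N -> V k <= D * w k) ->
  exists E, 0 <= E /\ forall k, V k <= E * w k.
Proof.
move=> w0 VD; have S0 : 0 <= \sum_(i < K) `|V i| / w i.
  by apply: sumr_ge0 => i _; rewrite divr_ge0// ltW.
exists (`|D| + \sum_(i < K) `|V i| / w i); split; first by rewrite addr_ge0.
move=> k; have [Kk|kK] := leqP K k.
  rewrite (le_trans (VD _ Kk))// ler_pM2r// (le_trans (ler_norm D))//.
  by rewrite lerDl.
rewrite -ler_pdivrMr// (bigD1 (Ordinal kK))//=.
rewrite (@le_trans _ _ (`|V k| / w k))//.
  by rewrite ler_pM2r ?invr_gt0// ler_norm.
rewrite addrCA lerDl addr_ge0// sumr_ge0// => i _.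
by rewrite divr_ge0// ltW.
Qed.

(** A form of Chung's lemma. Half of the contraction [r] pays for the decrease of the weight [w],
    the other half for the perturbation as soon as [D >= 2 * N]; the second entry of [D] starts the
    induction at [K]. *)
Lemma chung_bound (V r w : nat -> R) (N : R) (K : nat) : 0 <= N ->
  (forall k, (K <= k)%N -> 0 <= r k <= 1) ->
  (forall k, 0 < w k) ->
  (forall k, (K <= k)%N -> w k - w k.+1 <= r k / 2 * w k) ->
  (forall k, (K <= k)%N -> V k.+1 <= (1 - r k) * V k + N * r k * w k) ->
  exists D, 0 <= D /\ forall k, V k <= D * w k.
Proof.
move=> N0 r01 w0 hw hV.
pose D := Num.max (2 * N) (`|V K| / w K).
have DN : 2 * N <= D by rewrite /D le_max lexx.
suff H k : (K <= k)%N -> V k <= D * w k by exact: bound_all_of_eventually H.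
move=> /subnKC <-; elim: (k - K)%N => [|j IH].
  rewrite addn0 -ler_pdivrMr// /D le_max; apply/orP; right.
  by rewrite ler_pM2r ?invr_gt0// ler_norm.
rewrite addnS; set i := (K + j)%N in IH *.
have Ki : (K <= i)%N by rewrite leq_addr.
have /andP[r0 r1] := r01 _ Ki.
have D0 : 0 <= D by rewrite (le_trans _ DN)// mulr_ge0.
have h1 : (1 - r i) * V i <= (1 - r i) * (D * w i) by rewrite ler_wpM2l// subr_ge0.
have h2 : D * (w i - w i.+1) <= D * (r i / 2 * w i) by rewrite ler_wpM2l// hw.
have h3 : 0 <= (D - 2 * N) * (r i * w i).
  by rewrite mulr_ge0 ?subr_ge0// mulr_ge0// ltW.
have := hV _ Ki; lra.
Qed.

(* Three-timescale system: [e1] contracts at rate [g * l] only and receives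
   [g * (e2 + e3)], so the Lyapunov function weights [e2] and [e3] by [g]. *)
Lemma coupled_recursion (e1 e2 e3 g l h w : nat -> R) (c C q : R) :
  0 < c -> 0 < C -> 0 < q <= 1 ->
  (forall k, 0 <= e1 k) -> (forall k, 0 <= e2 k) -> (forall k, 0 <= e3 k) ->
  (forall k, 0 < g k) -> (forall k, 0 < l k) -> (forall k, 0 < h k) ->
  (forall k, 0 < w k) -> (forall k, g k.+1 <= g k) ->
  (forall k, h k = w k * (g k * l k)) ->
  (forall k, w k - w k.+1 <= h k * w k) ->
  (forall e : R, 0 < e -> \forall k \near \oo,
     [/\ g k <= e * l k, w k <= e & l k <= e]) ->
  (\forall k \near \oo, e1 k.+1 <=
     (1 - c * (g k * l k)) * e1 k + C * g k * (e2 k + e3 k) + C * h k) ->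
  (forall k, e2 k.+1 <= (1 - q) * e2 k + C * g k * (e1 k + e2 k + e3 k)) ->
  (forall k, e3 k.+1 <= (1 - q) * e3 k + C * e2 k +
     C * g k * (e1 k + e2 k + e3 k) + C * h k * (1 + e1 k + e2 k)) ->
  exists D, 0 <= D /\
    forall k, [/\ e1 k <= D * w k, e2 k <= D * w k & e3 k <= D * w k].
Proof.
move=> c0 C0 /andP[q0 q1] e10 e20 e30 g0 l0 h0 w0 gdec hE hw small E1 E2 E3.
(* [B] is fixed before [A] because [e2] enters the [e3] recursion without a factor [g]. The value
   [q * B = 2 * C] leaves room for the [C * e3] term of [e1], and [q * A = 2 * C * (1 + B)] for the
   [e2] terms coming from [e1] and from [B * e3]. *)
pose B := 2 * C / q; pose A := 2 * C * (1 + B) / q.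
have qB : q * B = 2 * C by rewrite /B; field; rewrite gt_eqF.
have qA : q * A = 2 * C * (1 + B) by rewrite /A; field; rewrite gt_eqF.
have B0 : 0 < B by rewrite divr_gt0// mulr_gt0.
have A0 : 0 < A by rewrite divr_gt0// mulr_gt0// ?mulr_gt0// addr_gt0.
(* [S] adds up the coefficients of the second-order terms: [e * S <= c / 2] absorbs them in the
   contraction of [e1], and [e * S <= C] in the slack of [e2] and [e3]. *)
pose S := (A + B) * C + B * C + (A + B) * c + 1.
have AC0 : 0 < A * C by exact: mulr_gt0.
have BC0 : 0 < B * C by exact: mulr_gt0.
have Ac0 : 0 < A * c by exact: mulr_gt0.
have Bc0 : 0 < B * c by exact: mulr_gt0.
have S0 : 0 < S by rewrite /S; lra.
(* The entries [c / 4] and [q / 8] are half the coefficients of the rates [c / 2 * (g k * l k)] and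
   [q / 4] at which [chung_bound] is applied below, so that [w] decreases slowly enough. *)
pose e := Num.min (1 : R) (Num.min (q / 8) (Num.min (c / 4) (Num.min (c / 2) C / S))).
have Se : 0 < Num.min (c / 2) C / S.
  by rewrite divr_gt0// lt_min C0 divr_gt0.
have e0 : 0 < e by rewrite /e !lt_min ltr01 Se !divr_gt0.
have ee1 : e <= 1 by rewrite /e ge_min lexx.
have eq8 : e <= q / 8 by rewrite /e !ge_min lexx !orbT.
have ec4 : e <= c / 4 by rewrite /e !ge_min lexx !orbT.
have eS : e * S <= Num.min (c / 2) C.
  by rewrite -ler_pdivlMr// /e !ge_min lexx !orbT.
have {}eS : e * S <= c / 2 /\ e * S <= C by move: eS; rewrite le_min => /andP.
case: eS => eSc eSC.
have [K _ HK] : \forall k \near \oo, [/\ g k <= e * l k, w k <= e, l k <= e &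
    e1 k.+1 <= (1 - c * (g k * l k)) * e1 k + C * g k * (e2 k + e3 k) + C * h k].
  by move: (small _ e0) E1; apply: filterS2 => k [].
pose V k := e1 k + g k * (A * e2 k + B * e3 k).
have facts k : (K <= k)%N -> [/\ 0 <= l k <= 1, 0 <= g k <= e, g k <= e * l k,
    0 <= h k <= e * (g k * l k) & 0 <= g k * l k <= e].
  move=> /HK[gl we le _]; have l1 : l k <= 1 by rewrite (le_trans le).
  have ge : g k <= e by rewrite (le_trans gl)// ler_piMr// ltW.
  have gl0 : 0 < g k * l k by exact: mulr_gt0.
  split; rewrite ?(ltW (l0 k)) ?(ltW (g0 k)) ?(ltW (h0 k)) ?(ltW gl0)//=.
    by rewrite hE ler_pM2r.
  by rewrite (le_trans _ ge)// ler_piMr// ltW.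
have V1 k : (K <= k)%N ->
    V k.+1 <= (1 - c / 2 * (g k * l k)) * V k +
      (2 * (C + B * C) / c) * (c / 2 * (g k * l k)) * w k.
  move=> Kk; have [/andP[lk0 lk1] /andP[gk0 gke] gle /andP[hk0 hke] /andP[gl0 gle1]]
    := facts _ Kk.
  have [_ _ _ H1] := HK _ Kk; have H2 := E2 k; have H3 := E3 k.
  have hle : h k <= e * l k.
    by rewrite (le_trans hke)// ler_wpM2l ?(ltW e0)// ler_piMl// (le_trans gke).
  have g1 : g k <= 1 by rewrite (le_trans gke).
  have -> : 2 * (C + B * C) / c * (c / 2 * (g k * l k)) * w k = (C + B * C) * h k.
    by rewrite hE; field; rewrite gt_eqF.
  have step : V k.+1 <= e1 k.+1 + g k * (A * e2 k.+1 + B * e3 k.+1).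
    rewrite /V lerD2l ler_wpM2r//.
    by rewrite addr_ge0// mulr_ge0// ltW.
  have H2' : g k * A * e2 k.+1 <= g k * A *
    ((1 - q) * e2 k + C * g k * (e1 k + e2 k + e3 k)).
    by rewrite ler_wpM2l// mulr_ge0// ltW.
  have H3' : g k * B * e3 k.+1 <= g k * B * ((1 - q) * e3 k + C * e2 k +
     C * g k * (e1 k + e2 k + e3 k) + C * h k * (1 + e1 k + e2 k)).
    by rewrite ler_wpM2l// mulr_ge0// ltW.
  have m1 : (A + B) * C * g k <= (A + B) * C * (e * l k).
    by rewrite ler_wpM2l// mulr_ge0 ?addr_ge0// ltW.
  have m2 : B * C * h k <= B * C * (e * l k) by rewrite ler_wpM2l// ltW.
  have m3 : (A + B) * c * (g k * l k) <= (A + B) * c * e.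
    by rewrite ler_wpM2l// mulr_ge0 ?addr_ge0// ltW.
  have m4 : e * S * l k <= c / 2 * l k by rewrite ler_wpM2r.
  have m5 : (A + B) * C * g k <= (A + B) * C * e.
    by rewrite ler_wpM2l// mulr_ge0 ?addr_ge0// ltW.
  have m6 : B * C * h k <= B * C * e.
    by rewrite ler_wpM2l ?(ltW BC0)// (le_trans hle)// ler_piMr// ltW.
  have Acgl : 0 <= A * c * (g k * l k) by rewrite mulr_ge0// ltW.
  have Bcgl : 0 <= B * c * (g k * l k) by rewrite mulr_ge0// ltW.
  have el0 : 0 <= e * l k by rewrite mulr_ge0// ltW.
  have BCh0 : 0 <= B * C * h k by rewrite mulr_ge0// ltW.
  have ABcel : 0 <= (A + B) * c * (e * l k) by rewrite mulr_ge0// mulr_ge0 ?addr_ge0// ltW.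
  (* [X1], [X2], [X3] are the slacks left in the coefficients of [e1], [e2], [e3] when only half of
     the rate [c] is claimed for [V]; [X4] uses [g k <= 1] on the drift term. *)
  have X1 : 0 <= (c / 2 * l k - (A + B) * C * g k - B * C * h k) * (g k * e1 k).
    by rewrite mulr_ge0 ?mulr_ge0//; move: m4; rewrite /S; lra.
  have X2 : 0 <= (q * A - C - B * C - (A + B) * C * g k - B * C * h k
      - A * c * (g k * l k) / 2) * (g k * e2 k).
    by rewrite mulr_ge0 ?mulr_ge0// qA; move: eSC; rewrite /S; lra.
  have X3 : 0 <= (q * B - C - (A + B) * C * g k - B * c * (g k * l k) / 2)
      * (g k * e3 k).
    by rewrite mulr_ge0 ?mulr_ge0// qB; move: eSC; rewrite /S; lra.
  have X4 : 0 <= (B * C * (1 - g k)) * h k.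
    by rewrite mulr_ge0// mulr_ge0 ?subr_ge0// ltW.
  rewrite (le_trans step)// /V; lra.
have [D1 [D10 HD1]] : exists D, 0 <= D /\ forall k, V k <= D * w k.
  apply: (@chung_bound V (fun k => c / 2 * (g k * l k)) w (2 * (C + B * C) / c) K) => //.
  - by rewrite divr_ge0 ?mulr_ge0 ?addr_ge0 ?ltW.
  - move=> k Kk; have [/andP[lk0 lk1] /andP[gk0 gke] gle _ /andP[gl0 gle1]] := facts _ Kk.
    rewrite mulr_ge0 ?divr_ge0 ?(ltW c0)//=.
    have t : c / 2 * (g k * l k) <= c / 2 * g k.
      by rewrite ler_wpM2l ?divr_ge0 ?(ltW c0)// ler_piMr.
    (* The size of [c] is controlled indirectly: [e * S <= C] contains [A * (c * e) <= C], and
       [A >= 2 * C] because [q <= 1], so [c * e <= 1 / 2]. *)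
    have A2C : 2 * C <= A.
      have : q * A <= A by rewrite ler_piMl// ltW.
      by move: qA BC0; lra.
    have ce : c * e <= 1 / 2.
      have t1 : 2 * C * (c * e) <= A * (c * e).
        by rewrite ler_wpM2r// mulr_ge0// ltW.
      have : 0 <= e * (A * C + B * C + B * C + B * c + 1).
        by rewrite mulr_ge0 ?(ltW e0)//; lra.
      have : 2 * C * (c * e) <= 2 * C * (1 / 2) -> c * e <= 1 / 2.
        by rewrite ler_pM2l// mulr_gt0.
      by move: eSC t1; rewrite /S; lra.
    have : c / 2 * g k <= c / 2 * e by rewrite ler_wpM2l ?divr_ge0 ?(ltW c0).
    by move: t ce; lra.
  - move=> k Kk; rewrite (le_trans (hw k))// ler_wpM2r ?(ltW (w0 k))//.
    have [_ _ _ /andP[_ hke] /andP[gl0 _]] := facts _ Kk.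
    have : e * (g k * l k) <= c / 4 * (g k * l k) by rewrite ler_wpM2r.
    by move: hke; lra.
have e1D k : e1 k <= D1 * w k.
  rewrite (le_trans _ (HD1 k))// /V lerDl mulr_ge0 ?(ltW (g0 k))//.
  by rewrite addr_ge0// mulr_ge0// ltW.
(* [N] collects what remains beside [e2] and [e3] in the recursion of [A * e2 + B * e3] once
   [e1 <= D1 * w] and [h <= w] are inserted. *)
pose N := (A + B) * C * D1 + B * C + B * C * D1.
have N0 : 0 <= N.
  have ABC : 0 <= (A + B) * C * D1 by rewrite mulr_ge0// mulr_ge0 ?addr_ge0// ltW.
  have BCD : 0 <= B * C * D1 by rewrite mulr_ge0// ltW.
  by rewrite /N; lra.
have [D2 [D20 HD2]] : exists D, 0 <= D /\ forall k, A * e2 k + B * e3 k <= D * w k.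
  apply: (@chung_bound _ (fun=> q / 4) w (N * (4 / q)) K) => //.
  - by rewrite mulr_ge0// divr_ge0// ltW.
  - by move=> k _; lra.
  - move=> k Kk; rewrite (le_trans (hw k))// ler_wpM2r ?(ltW (w0 k))//.
    have [_ _ _ /andP[_ hke] /andP[gl0 gl1]] := facts _ Kk.
    have : e * (g k * l k) <= e * 1 by rewrite ler_wpM2l ?(ltW e0)// (le_trans gl1).
    by move: hke; lra.
  - move=> k Kk; have [/andP[lk0 lk1] /andP[gk0 gke] gle /andP[hk0 hke] /andP[gl0 gle1]]
      := facts _ Kk.
    have g1 : g k <= 1 by rewrite (le_trans gke).
    have gl1 : g k * l k <= 1 by rewrite (le_trans gle1).
    have he : h k <= e by rewrite (le_trans hke)// ler_piMr// ltW.
    have hw1 : h k <= w k by rewrite hE ler_piMr// ltW.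
    have -> : N * (4 / q) * (q / 4) * w k = N * w k.
      by field; rewrite gt_eqF.
    have H2' := E2 k; have H3' := E3 k.
    have {}H2' : A * e2 k.+1 <= A *
      ((1 - q) * e2 k + C * g k * (e1 k + e2 k + e3 k)) by rewrite ler_wpM2l// ltW.
    have {}H3' : B * e3 k.+1 <= B * ((1 - q) * e3 k + C * e2 k +
       C * g k * (e1 k + e2 k + e3 k) + C * h k * (1 + e1 k + e2 k)).
      by rewrite ler_wpM2l// ltW.
    have ABC0 : 0 <= (A + B) * C by rewrite mulr_ge0 ?addr_ge0// ltW.
    have m5 : (A + B) * C * g k <= (A + B) * C * e by rewrite ler_wpM2l.
    have m6 : B * C * h k <= B * C * e by rewrite ler_wpM2l// ltW.
    have ABce : 0 <= (A + B) * c * e by rewrite mulr_ge0 ?mulr_ge0 ?addr_ge0// ltW.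
    have BCe : 0 <= B * C * e by rewrite mulr_ge0// ltW.
    have Y2 : 0 <= (3 / 4 * (q * A) - B * C - (A + B) * C * g k - B * C * h k) * e2 k.
      by rewrite mulr_ge0// qA; move: eSC; rewrite /S; lra.
    have Y3 : 0 <= (3 / 4 * (q * B) - (A + B) * C * g k) * e3 k.
      by rewrite mulr_ge0// qB; move: eSC; rewrite /S; lra.
    have n1 : (A + B) * C * (g k * e1 k) <= (A + B) * C * (D1 * w k).
      by rewrite ler_wpM2l// (le_trans _ (e1D k))// ler_piMl.
    have n2 : B * C * h k <= B * C * w k by rewrite ler_wpM2l// ltW.
    have n3 : B * C * (h k * e1 k) <= B * C * (D1 * w k).
      rewrite ler_wpM2l ?(ltW BC0)// (le_trans _ (e1D k))// ler_piMl//.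
      by rewrite (le_trans he).
    by rewrite /N; lra.
exists (D1 + D2 / A + D2 / B); split.
  by rewrite !addr_ge0// divr_ge0// ltW.
move=> k; have wk := w0 k; have DA : 0 <= D2 / A * w k.
  by rewrite mulr_ge0 ?(ltW wk)// divr_ge0// ltW.
have DB : 0 <= D2 / B * w k.
  by rewrite mulr_ge0 ?(ltW wk)// divr_ge0// ltW.
have DD : 0 <= D1 * w k by rewrite mulr_ge0// ltW.
have Ae : 0 <= A * e2 k by rewrite mulr_ge0// ltW.
have Be : 0 <= B * e3 k by rewrite mulr_ge0// ltW.
have H := HD2 k; split; rewrite !mulrDl.
- by move: (e1D k); lra.
- have : e2 k <= D2 / A * w k.
    by rewrite mulrAC ler_pdivlMr// mulrC; lra.
  by lra.
- have : e3 k <= D2 / B * w k.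
    by rewrite mulrAC ler_pdivlMr// mulrC; lra.
  by lra.
Qed.

End recursions.

(** * Strongly convex functions *)

Section enorm_topology.
Context {R : realType} {n : nat}.
Implicit Types x z : 'rV[R]_n.

Lemma normr_le_enorm x : `|x| <= enorm x.
Proof.
rewrite [`|x|]mx_normrE; apply: bigmax_le => [|ij _]; [exact: enorm_ge0|exact: ler_enorm].
Qed.

Lemma enorm_le_normr x : enorm x <= `|x| * enorm (const_mx 1 : 'rV[R]_n).
Proof.
rewrite -[X in X * _]ger0_norm// -enormZ !enormE /l2norm ler_wsqrtr//.
apply: ler_sum => ij _; rewrite !mxE mulr1 -[X in X <= _]real_normK ?num_real//.
rewrite ler_pXn2r// ?nnegrE// [`|x|]mx_normrE; exact: (le_bigmax _ (fun ij => `|x ij.1 ij.2|)).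
Qed.

(** The topology on row vectors comes from the maximum norm while all estimates are Euclidean; the
    two norms are equivalent. *)
Lemma cvg_enorm_dist (x_ : nat -> 'rV[R]_n) z :
  enorm (x_ k - z) @[k --> \oo] --> (0 : R) <-> x_ k @[k --> \oo] --> z.
Proof.
split=> H.
  apply/cvgrPdist_lt => e e0; move/cvgrPdist_lt : H => /(_ _ e0).
  apply: filterS => k; rewrite sub0r normrN ger0_norm ?enorm_ge0// distrC.
  exact/le_lt_trans/normr_le_enorm.
have H' : `|x_ k - z| @[k --> \oo] --> (0 : R).
  rewrite -(normr0 'rV[R]_n) -(subrr z); apply: cvg_norm; apply: cvgB => //.
  exact: cvg_cst.
apply: (@squeeze_cvgr _ _ _ _ (fun=> 0)
  (fun k => `|x_ k - z| * enorm (const_mx 1 : 'rV[R]_n))).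
- by near=> k; rewrite enorm_ge0 enorm_le_normr.
- exact: cvg_cst.
- rewrite -[X in _ --> X](mul0r (enorm (const_mx 1 : 'rV[R]_n))).
  exact: cvgMl.
Unshelve. all: end_near. Qed.

(** The hypotheses make [u] nondecreasing and bounded, hence convergent; its increments dominate the
    squared distances, so the vectors form a Cauchy sequence. *)
Lemma cvg_of_sqr_dist_le (x_ : nat -> 'rV[R]_n) (u : nat -> R) (c M : R) : 0 < c ->
  (forall k, u k <= M) ->
  (forall k l, (k <= l)%N -> c * enorm (x_ k - x_ l) ^+ 2 <= u l - u k) ->
  exists z, enorm (x_ k - z) @[k --> \oo] --> (0 : R).
Proof.
move=> c0 uM hu.
have ndu : nondecreasing_seq u.
  move=> k l kl; rewrite -subr_ge0 (le_trans _ (hu _ _ kl))//.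
  by rewrite mulr_ge0 ?sqr_ge0 ?ltW.
have cu : cvgn u.
  apply: nondecreasing_is_cvgn => //; exists M => _ [k _ <-]; exact: uM.
have ul k : u k <= limn u by exact: nondecreasing_cvgn_le.
suff /cauchy_cvgP/cvg_ex[z xz] : cauchy (x_ @ \oo) by exists z; apply/cvg_enorm_dist.
apply/cauchyP => e e0; have d0 : 0 < c * e ^+ 2 by rewrite mulr_gt0 ?exprn_gt0.
move/cvgrPdist_lt : (cu) => /(_ _ d0)[N _ HN]; exists (x_ N).
exists N => // k /= Nk; rewrite -ball_normE/=.
apply: le_lt_trans (normr_le_enorm _) _.
rewrite -(@ltr_pXn2r _ 2)// ?nnegrE ?enorm_ge0 ?(ltW e0)// -(ltr_pM2l c0).
apply: le_lt_trans (hu _ _ Nk) _; have /= := HN N (leqnn N).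
rewrite ger0_norm ?subr_ge0 ?ul//; apply: le_lt_trans.
by rewrite lerD2r ul.
Qed.

End enorm_topology.

Section convex_gradient.
Context {R : realType} {n : nat}.

(** Convexity along the segment bounds the difference quotient by [K + E * t]. The limit is taken
    from the right, as the inequality is available only for [t] in [0, 1]. *)
Lemma strongly_convex_first_order (mu : R) (f : 'rV[R]_n -> R) x y d :
  strongly_convex_eucl mu f -> is_derive x (y - x) f d ->
  f x + d + mu / 2 * enorm (y - x) ^+ 2 <= f y.
Proof.
move=> sc [df fd].
have H : (fun t : R => t^-1 *: (f (t *: (y - x) + x) - f x)) t @[t --> 0^'] --> d.
  by rewrite -fd; exact: df.
have {}H := cvg_dnbhs_at_right H.
pose K := f y - f x - mu / 2 * enorm (y - x) ^+ 2.
pose E := mu / 2 * enorm (y - x) ^+ 2.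
have H2 : K + E * t @[t --> (0:R)^'+] --> K + E * 0.
  apply: cvgD; first exact: cvg_cst.
  by apply: cvgMr; apply: cvg_at_right_filter; exact: cvg_id.
suff : d <= K + E * 0 by rewrite /K /E; lra.
apply: (ler_cvg_to H H2); near=> t.
have t0 : 0 < t by [].
have t1 : t <= 1 by near: t; apply: nbhs_right_le.
have := sc y x t; rewrite ltW// t1 => /(_ isT).
have -> : t *: y + (1 - t) *: x = t *: (y - x) + x.
  by rewrite scalerBr scalerBl scale1r -[RHS]addrA [- _ + x]addrC.
move=> le; rewrite /GRing.scale/= mulrC ler_pdivrMr// /K /E.
by move: le; lra.
Unshelve. all: end_near. Qed.

Lemma is_derive_sum_gradient m (f : 'I_m -> 'rV[R]_n -> R)
    (gf : 'I_m -> 'rV[R]_n -> 'rV[R]_n) x h :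
  (forall i, is_C1_gradient (f i) (gf i)) ->
  is_derive x h (fun z => \sum_(i < m) f i z) (dotr (\sum_(i < m) gf i x) h).
Proof.
move=> hg; have -> : (fun z => \sum_(i < m) f i z) = \sum_(i < m) f i.
  by apply/funext => z; rewrite fct_sumE.
have -> : dotr (\sum_(i < m) gf i x) h = \sum_(i < m) dotr (gf i x) h.
  elim/big_rec2 : _ => [|i a b _ <-]; last by rewrite dotrDl.
  by rewrite dotrE big1// => j _; rewrite mxE mul0r.
apply: is_derive_sum => i; have [df [dE _]] := hg i.
by split; [exact: diff_derivable|rewrite deriveE// dE].
Qed.

End convex_gradient.

(** * The path of regularized solutions *)

Section regularized_path.
Context {R : realType} {n : nat}.
Variables (f : 'rV[R]_n -> R) (F g : 'rV[R]_n -> 'rV[R]_n).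
Variables (mu LF Lg : R) (xs : 'rV[R]_n) (xl : R -> 'rV[R]_n).
Hypothesis mu0 : 0 < mu.
Hypothesis hf : forall x y,
  f x + dotr (g x) (y - x) + mu / 2 * enorm (y - x) ^+ 2 <= f y.
Hypothesis hF : monotone_op F.
Hypotheses (F_lip : lip_eucl LF F) (g_lip : lip_eucl Lg g).
Hypothesis Fxs : F xs = 0.
Hypothesis xs_min : forall y, F y = 0 -> f xs <= f y.
Hypothesis hxl : forall l, 0 < l -> F (xl l) + l *: g (xl l) = 0.

Lemma gradient_strongly_monotone x y :
  mu * enorm (x - y) ^+ 2 <= dotr (g x - g y) (x - y).
Proof.
have := hf x y; have := hf y x.
rewrite (enorm_distC y x) -(opprB x y) !dotr_lin; lra.
Qed.

Lemma F_xl l : 0 < l -> F (xl l) = - (l *: g (xl l)).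
Proof. by move=> /hxl/eqP; rewrite addr_eq0 => /eqP. Qed.

Lemma dotr_gradient_xl l : 0 < l -> dotr (g (xl l)) (xl l - xs) <= 0.
Proof.
move=> l0; have := hF (xl l) xs; rewrite Fxs subr0 F_xl// dotrNl dotrZl.
by rewrite oppr_ge0 pmulr_rle0.
Qed.

(** Strong monotonicity of [g], set against the sign in [dotr_gradient_xl], gives a radius
    independent of [l]. *)
Lemma xl_dist_le l : 0 < l -> enorm (xl l - xs) <= enorm (g xs) / mu.
Proof.
move=> l0; have h1 := dotr_gradient_xl l l0.
have h2 := gradient_strongly_monotone (xl l) xs.
have h3 := dotr_CS (- g xs) (xl l - xs); rewrite enormN in h3.
rewrite ler_pdivlMr//.
have [->|e0] := eqVneq (enorm (xl l - xs)) 0; first by rewrite mul0r enorm_ge0.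
have ep : 0 < enorm (xl l - xs) by rewrite lt_neqAle enorm_ge0 eq_sym e0.
rewrite -(ler_pM2r ep); move: h2 h3; rewrite dotrDl dotrNl; lra.
Qed.

(** Lipschitz propagation from [xs] over the radius of [xl_dist_le]. The absolute value keeps the
    bound nonnegative whatever the sign of [Lg]. *)
Definition xl_grad_bound : R := enorm (g xs) + `|Lg| * (enorm (g xs) / mu).

Lemma xl_grad_bound_ge0 : 0 <= xl_grad_bound.
Proof. by rewrite addr_ge0 ?enorm_ge0// mulr_ge0// divr_ge0 ?enorm_ge0// ltW. Qed.

Lemma enorm_gradient_xl l : 0 < l -> enorm (g (xl l)) <= xl_grad_bound.
Proof.
move=> l0; rewrite -[g (xl l)](subrK (g xs)) addrC.
apply: le_trans (enormD _ _) _; rewrite lerD2l.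
apply: le_trans (g_lip _ _) _.
apply: (@le_trans _ _ (`|Lg| * enorm (xl l - xs))).
  by rewrite ler_wpM2r ?enorm_ge0// ler_norm.
by rewrite ler_wpM2l// xl_dist_le.
Qed.

Lemma xl_diff_dotr l1 l2 : 0 < l1 -> 0 < l2 ->
  0 <= dotr (l2 *: g (xl l2) - l1 *: g (xl l1)) (xl l1 - xl l2).
Proof.
move=> l10 l20; have := hF (xl l1) (xl l2).
by rewrite !F_xl// opprK addrC.
Qed.

(** Splitting [l2 g2 - l1 g1] as [(l2 - l1) g2 - l1 (g1 - g2)] sets strong monotonicity against the
    change of parameter. Division by [l1] leaves the relative drift, the quantity that is of order
    1/s. *)
Lemma xl_lipschitz l1 l2 : 0 < l1 -> 0 < l2 ->
  enorm (xl l2 - xl l1) <= `|1 - l2 / l1| * (xl_grad_bound / mu).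
Proof.
move=> l10 l20; set d := xl l1 - xl l2; rewrite enorm_distC -/d.
have h1 := xl_diff_dotr l1 l2 l10 l20.
have h2 := gradient_strongly_monotone (xl l1) (xl l2); rewrite -/d in h1 h2.
have h3 := dotr_CS ((l2 - l1) *: g (xl l2)) d.
rewrite enormZ in h3.
have h4 : `|l2 - l1| = l1 * `|1 - l2 / l1|.
  rewrite distrC -[X in X * _](gtr0_norm l10) -normrM; congr `|_|.
  by field; rewrite gt_eqF.
rewrite h4 in h3.
have h5 : l1 * `|1 - l2 / l1| * enorm (g (xl l2)) <= l1 * `|1 - l2 / l1| * xl_grad_bound.
  by rewrite ler_wpM2l ?enorm_gradient_xl// mulr_ge0// ltW.
rewrite mulrA ler_pdivlMr//.
have [->|e0] := eqVneq (enorm d) 0.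
  by rewrite mul0r mulr_ge0// xl_grad_bound_ge0.
have ep : 0 < enorm d by rewrite lt_neqAle enorm_ge0 eq_sym e0.
rewrite -(ler_pM2r ep) -(ler_pM2l l10).
have h6 : l1 * `|1 - l2 / l1| * enorm (g (xl l2)) * enorm d <=
  l1 * `|1 - l2 / l1| * xl_grad_bound * enorm d by rewrite ler_wpM2r ?enorm_ge0.
have h7 : l1 * (mu * enorm d ^+ 2) <= l1 * dotr (g (xl l1) - g (xl l2)) d.
  by rewrite ler_pM2l.
by move: h1 h3 h6 h7; clearbody d; rewrite !dotr_lin; lra.
Qed.

(* Along the path [f] increases as the regularization decreases, which turns
   boundedness of [f] into the Cauchy property of the path. *)
Lemma xl_gap l1 l2 : 0 < l2 -> l2 <= l1 ->
  mu / 2 * enorm (xl l1 - xl l2) ^+ 2 <= f (xl l2) - f (xl l1).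
Proof.
move=> l20 l21; have l10 := lt_le_trans l20 l21.
set d := xl l1 - xl l2.
have h1 := xl_diff_dotr l1 l2 l10 l20.
have h2 := gradient_strongly_monotone (xl l1) (xl l2); rewrite -/d in h1 h2.
have d2 : 0 <= mu * enorm d ^+ 2 by rewrite mulr_ge0 ?sqr_ge0// ltW.
have h3 := hf (xl l1) (xl l2); rewrite enorm_distC -opprB -/d in h3.
have Ed : d = xl l1 - xl l2 by []; clearbody d.
move: h1 h2 h3; rewrite !dotr_lin => h1 h2 h3.
suff : dotr (g (xl l1)) d <= 0 by lra.
have {h2 d2} h4 : dotr (g (xl l2)) d <= dotr (g (xl l1)) d by lra.
(* Were this product positive, [h1] and [h4] would give [l1 <= l2], hence [l1 = l2] and [d = 0], a
   contradiction. *)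
rewrite leNgt; apply/negP => p.
have : l2 * dotr (g (xl l2)) d <= l2 * dotr (g (xl l1)) d by rewrite ler_pM2l.
have [E|] := eqVneq l1 l2; last first.
  move=> ne; have lt : l2 < l1 by rewrite lt_neqAle eq_sym ne.
  have : l2 * dotr (g (xl l1)) d < l1 * dotr (g (xl l1)) d by rewrite ltr_pM2r.
  by move: h1; lra.
by move: p; rewrite Ed E subrr dotrE big1 ?ltxx// => j _; rewrite mxE mulr0.
Qed.

(** First-order inequality at [xl l], whose linear term has a favourable sign. It caps [f] along the
    path and also measures the distance to [xs], which later identifies the limit. *)
Lemma f_xl_le l : 0 < l -> f (xl l) + mu / 2 * enorm (xl l - xs) ^+ 2 <= f xs.
Proof.
move=> l0; have := hf (xl l) xs; have := dotr_gradient_xl l l0.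
by rewrite enorm_distC -(opprB (xl l) xs) dotrNr; lra.
Qed.

Lemma xl_cvg (l_ : nat -> R) : (forall k, 0 < l_ k) ->
  (forall j k, (j <= k)%N -> l_ k <= l_ j) -> l_ k @[k --> \oo] --> (0 : R) ->
  enorm (xl (l_ k) - xs) @[k --> \oo] --> (0 : R).
Proof.
move=> l0 ldec lim0.
have [z xz] : exists z, enorm (xl (l_ k) - z) @[k --> \oo] --> (0 : R).
  apply: (@cvg_of_sqr_dist_le _ _ (fun k => xl (l_ k)) (fun k => f (xl (l_ k)))
    (mu / 2) (f xs)); first by rewrite divr_gt0.
    move=> k; apply: le_trans (f_xl_le _ (l0 k)).
    by rewrite lerDl mulr_ge0 ?sqr_ge0// divr_ge0// ltW.
  by move=> j k jk; apply: xl_gap => //; exact: ldec.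
(* [F (xl l)] has norm at most [l * xl_grad_bound], which vanishes with [l]; the Lipschitz bound
   carries this to the limit. *)
have Fz : F z = 0.
  apply: enorm_eq0; apply/eqP; rewrite eq_le enorm_ge0 andbT.
  have H : LF * enorm (xl (l_ k) - z) + l_ k * xl_grad_bound @[k --> \oo]
      --> LF * 0 + 0 * xl_grad_bound.
    by apply: cvgD; [exact: cvgMr|exact: cvgMl].
  rewrite mulr0 mul0r addr0 in H.
  apply: (cvgr_to_ge H); near=> k.
  rewrite -[F z](subrK (F (xl (l_ k)))); apply: le_trans (enormD _ _) _.
  rewrite enorm_distC lerD//.
  rewrite F_xl// enormN enormZ (gtr0_norm (l0 k)) ler_pM2l//.
  exact: enorm_gradient_xl.
(* The bounds [f_xl_le] and [f xs <= f z], combined with the first-order inequality at [z], bound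
   the squared distance to [xs] by this sequence. *)
have H1 : 2 / mu * (enorm (g z) * enorm (xl (l_ k) - z)) @[k --> \oo] --> (0 : R).
  rewrite -[X in _ --> X](mulr0 (2 / mu)); apply: cvgMr.
  by rewrite -[X in _ --> X](mulr0 (enorm (g z))); exact: cvgMr.
have H2 : enorm (xl (l_ k) - xs) ^+ 2 @[k --> \oo] --> (0 : R).
  apply: (squeeze_cvgr _ (cvg_cst 0) H1); near=> k; rewrite sqr_ge0/=.
  have h1 := f_xl_le _ (l0 k); have h2 := xs_min _ Fz.
  have h3 := hf z (xl (l_ k)); have h4 := dotr_CS (- g z) (xl (l_ k) - z).
  rewrite enormN dotrNl in h4.
  have h5 : 0 <= mu / 2 * enorm (xl (l_ k) - z) ^+ 2.
    by rewrite mulr_ge0 ?sqr_ge0// divr_ge0// ltW.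
  have m2 : 0 < mu / 2 by rewrite divr_gt0.
  rewrite -(ler_pM2l m2) [leRHS]mulrA.
  rewrite (_ : mu / 2 * (2 / mu) = 1) ?mul1r; last by field; rewrite gt_eqF.
  by lra.
apply/cvgrPdist_lt => e e0; have e20 : 0 < e ^+ 2 by rewrite exprn_gt0.
move/cvgrPdist_lt : H2 => /(_ _ e20); apply: filterS => k.
rewrite !sub0r !normrN normrX ger0_norm ?enorm_ge0//.
by rewrite ltr_pXn2r// ?nnegrE ?enorm_ge0// ltW.
Unshelve. all: end_near. Qed.

End regularized_path.

(** * One step of IR-Push-Pull *)

(** In the expanded square, [s * L ^+ 2 <= mu] lets half of the linear gain [2 * s * mu] absorb the
    quadratic term. What is left, [1 - s * mu], is at most [(1 - s * mu / 2) ^+ 2]. *)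
Lemma strongly_monotone_step {R : realType} {n : nat} (d T : 'rV[R]_n) (mu L s : R) :
  0 <= s -> 0 <= L -> mu * enorm d ^+ 2 <= dotr T d -> enorm T <= L * enorm d ->
  s * L ^+ 2 <= mu -> s * mu <= 1 ->
  enorm (d - s *: T) <= (1 - s * mu / 2) * enorm d.
Proof.
move=> s0 L0 Td TL sL smu.
have p0 : 0 <= 1 - s * mu / 2 by lra.
rewrite -(@ler_pXn2r _ 2)// ?nnegrE ?mulr_ge0 ?enorm_ge0//.
have T2 : enorm T ^+ 2 <= L ^+ 2 * enorm d ^+ 2.
  by rewrite -exprMn ler_pXn2r// ?nnegrE ?mulr_ge0 ?enorm_ge0.
have -> : enorm (d - s *: T) ^+ 2 =
    enorm d ^+ 2 - 2 * s * dotr T d + s ^+ 2 * enorm T ^+ 2.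
  by rewrite !sqr_enorm_row !dotr_lin (dotrC d T); ring.
have d2 := sqr_ge0 (enorm d).
have h1 : s * (mu * enorm d ^+ 2) <= s * dotr T d by rewrite ler_wpM2l.
have h2 : s ^+ 2 * enorm T ^+ 2 <= s ^+ 2 * (L ^+ 2 * enorm d ^+ 2).
  by rewrite ler_wpM2l// sqr_ge0.
have h3 : s * enorm d ^+ 2 * (s * L ^+ 2) <= s * enorm d ^+ 2 * mu.
  by rewrite ler_wpM2l// mulr_ge0.
have h4 : 0 <= (s * mu) ^+ 2 * enorm d ^+ 2 by rewrite mulr_ge0// sqr_ge0.
lra.
Qed.

Lemma enorm_diag_mulmx {R : realType} {m n : nat} (d : 'rV[R]_m) (W : 'M[R]_(m, n)) (c : R) :
  (forall j, 0 <= d 0 j <= c) -> 0 <= c -> enorm (diag_mx d *m W) <= c * enorm W.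
Proof.
move=> dc c0; apply: enorm_rows_le => // i.
rewrite row_mul row_diag_mx -scalemxAl -rowE enormZ.
by have /andP[d0 d1] := dc i; rewrite ger0_norm// ler_wpM2r// enorm_ge0.
Qed.

Section one_step.
Context {R : realType} {m n : nat}.
Hypothesis m0 : (0 < m)%N.
Variables (F gf : 'I_m -> 'rV[R]_n -> 'rV[R]_n) (LF Lg : R).
Hypotheses (LF0 : 0 < LF) (Lg0 : 0 < Lg).
Hypotheses (F_lip : forall i, lip_eucl LF (F i)) (g_lip : forall i, lip_eucl Lg (gf i)).
Variables (Rm Cm : 'M[R]_m) (u v : 'cV[R]_m).
Local Notation one := (const_mx 1 : 'cV[R]_m).
Local Notation mR := (m%:R : R).
Hypotheses (hRrow : Rm *m one = one) (hCcol : one^T *m Cm = one^T).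
Hypotheses (hu : u^T *m Rm = u^T) (hv : Cm *m v = v).
Hypotheses (hu1 : u^T *m one = mR%:M) (hv1 : one^T *m v = mR%:M).

Let mR0 : 0 < mR. Proof. by rewrite ltr0n. Qed.
Let mRn0 : mR != 0. Proof. by rewrite gt_eqF. Qed.

Definition stack (H : 'I_m -> 'rV[R]_n -> 'rV[R]_n) (X : 'M[R]_(m, n)) : 'M[R]_(m, n) :=
  \matrix_(i, j) H i (row i X) 0 j.

Lemma row_stack H X i : row i (stack H X) = H i (row i X).
Proof. by apply/rowP => j; rewrite !mxE. Qed.

Lemma row_one (z : 'rV[R]_n) i : row i (one *m z) = z.
Proof.
apply/rowP => j; rewrite !mxE (bigD1 0)//= big1 ?addr0 ?mxE ?mul1r//.
by move=> k; rewrite ord1.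
Qed.

Lemma oneT_mul (W : 'M[R]_(m, n)) : one^T *m W = \sum_i row i W.
Proof.
apply/rowP => j; rewrite mxE summxE; apply: eq_bigr => i _.
by rewrite !mxE mul1r.
Qed.

Lemma stack_lip L H X Z : 0 <= L -> (forall i, lip_eucl L (H i)) ->
  enorm (stack H X - stack H Z) <= L * enorm (X - Z).
Proof.
move=> L0 HL; apply: enorm_rows_le => // i; rewrite !linearB/= !row_stack; exact: HL.
Qed.

(** The quantity tracked by the [y] iterates: at consensus its column sum is the regularized map
    whose zero is the point of the path. *)
Definition reg_map (l : R) : 'M[R]_(m, n) -> 'M[R]_(m, n) :=
  stack (fun i z => F i z + l *: gf i z).

Lemma reg_mapE l X : reg_map l X = stack F X + l *: stack gf X.
Proof. by apply/matrixP => i j; rewrite !mxE. Qed.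

Variable (lmax : R).

Lemma reg_map_lip l X Z : 0 <= l <= lmax ->
  enorm (reg_map l X - reg_map l Z) <= (LF + lmax * Lg) * enorm (X - Z).
Proof.
move=> /andP[l0 l1]; rewrite !reg_mapE opprD addrACA -scalerBr.
apply: le_trans (enormD _ _) _; rewrite mulrDl lerD//.
  exact: stack_lip (ltW _) _.
rewrite enormZ ger0_norm// -mulrA ler_pM ?enorm_ge0//.
exact: stack_lip (ltW _) _.
Qed.

Local Notation SR := (Rm - mR^-1 *: (one *m u^T)).
Local Notation SC := (Cm - mR^-1 *: (v *m one^T)).
Local Notation av u X := (mR^-1 *: (u^T *m X)).

Lemma SR_one (z : 'rV[R]_n) : SR *m (one *m z) = 0.
Proof.
rewrite mulmxA mulmxBl hRrow -scalemxAl -mulmxA hu1 mul_mx_scalar scalerA.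
by rewrite mulVf// scale1r subrr mul0mx.
Qed.

Lemma SC_v (z : 'rV[R]_n) : SC *m (v *m z) = 0.
Proof.
rewrite mulmxA mulmxBl hv -scalemxAl -mulmxA hv1 mul_mx_scalar scalerA.
by rewrite mulVf// scale1r subrr mul0mx.
Qed.

(** [u^T Rm = u^T] makes averaging commute with mixing, and the deflated matrix annihilates
    consensus vectors; the error thus evolves under the contraction alone, up to the step [D]. *)
Lemma consensus_x (X D : 'M[R]_(m, n)) :
  Rm *m (X - D) - one *m av u (Rm *m (X - D)) = SR *m ((X - one *m av u X) - D).
Proof.
rewrite mulmxA hu [X - _ - D]addrAC [in RHS]mulmxBr SR_one subr0.
by rewrite [in RHS]mulmxBl -scalemxAr -scalemxAl mulmxA.
Qed.

(** Dual to [consensus_x]: [Cm] preserves column sums and fixes [v], so the deflated matrix acts on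
    the error while the increment [D] is only projected along [v]. *)
Lemma consensus_y (Y D : 'M[R]_(m, n)) :
  Cm *m Y + D - v *m av one (Cm *m Y + D) =
  SC *m (Y - v *m av one Y) + (1%:M - mR^-1 *: (v *m one^T)) *m D.
Proof.
rewrite mulmxDr mulmxA hCcol [in RHS]mulmxBr SC_v subr0 !mulmxBl mul1mx.
by rewrite -!scalemxAl -!mulmxA -scalemxAr mulmxDr scalerDr opprD addrACA.
Qed.

Lemma oneT_reg_map l z : one^T *m reg_map l (one *m z) = \sum_i F i z + l *: \sum_i gf i z.
Proof.
rewrite oneT_mul scaler_sumr -big_split; apply: eq_bigr => i _.
by rewrite row_stack row_one.
Qed.

Variables (x y : nat -> 'M[R]_(m, n)) (gam : nat -> 'rV[R]_m) (g l h : nat -> R).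
Variables (xk : nat -> 'rV[R]_n) (xs : 'rV[R]_n) (P mu theta q : R).
Hypothesis (hx : forall k, x k.+1 = Rm *m (x k - diag_mx (gam k) *m y k)).
Hypothesis (hy0 : y 0%N = reg_map (l 0%N) (x 0%N)).
Hypothesis (hy : forall k,
  y k.+1 = Cm *m y k + (reg_map (l k.+1) (x k.+1) - reg_map (l k) (x k))).
Hypothesis (hgam : forall k j, 0 <= gam k 0 j <= g k).
Hypotheses (g0 : forall k, 0 < g k) (h0 : forall k, 0 < h k).
Hypotheses (l0 : forall k, 0 < l k) (l_max : forall k, l k <= lmax).
Hypothesis l_drift : forall k, `|l k.+1 - l k| <= lmax * h k.
Hypotheses (mu0 : 0 < mu) (theta0 : 0 < theta) (P0 : 0 <= P).
Hypothesis T_mono : forall k z z',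
  mu * l k * enorm (z - z') ^+ 2 <=
  dotr (one^T *m reg_map (l k) (one *m z) - one^T *m reg_map (l k) (one *m z')) (z - z').
Hypothesis xk_zero : forall k, one^T *m reg_map (l k) (one *m xk k) = 0.
Hypothesis xk_bound : forall k, enorm (xk k - xs) <= P.
Hypothesis xk_drift : forall k, enorm (xk k.+1 - xk k) <= P * h k.
Hypothesis alpha_ge : forall k,
  theta * g k <= (mR^-1 *: (u^T *m diag_mx (gam k) *m v)) 0 0.
Variables (NR NC : 'cV[R]_m -> R) (KR KC : R).
Hypotheses (hNR : is_vnorm NR) (hNC : is_vnorm NC).
Hypotheses (KR0 : 0 <= KR) (KC0 : 0 <= KC) (q01 : 0 < q <= 1).
Hypothesis enorm_le_NR : forall W : 'M[R]_(m, n), enorm W <= mxnorm NR W.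
Hypothesis enorm_le_NC : forall W : 'M[R]_(m, n), enorm W <= mxnorm NC W.
Hypothesis NR_le_enorm : forall W : 'M[R]_(m, n), mxnorm NR W <= KR * enorm W.
Hypothesis NC_le_enorm : forall W : 'M[R]_(m, n), mxnorm NC W <= KC * enorm W.
Hypothesis SR_contr : forall z, NR (SR *m z) <= (1 - q) * NR z.
Hypothesis SC_contr : forall z, NC (SC *m z) <= (1 - q) * NC z.

Local Notation xb k := (av u (x k)).
Local Notation yb k := (av one (y k)).
Local Notation Lb := (LF + lmax * Lg).
Local Notation o := (enorm one).
Local Notation e1 k := (enorm (xb k - xk k)).
Local Notation e2 k := (mxnorm NR (x k - one *m xb k)).
Local Notation e3 k := (mxnorm NC (y k - v *m yb k)).
Local Notation D k := (diag_mx (gam k)).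

Let lmax0 : 0 < lmax. Proof. exact: lt_le_trans (l0 0) (l_max 0). Qed.
Let Lb0 : 0 < Lb. Proof. by rewrite addr_gt0// mulr_gt0. Qed.
Let l01 k : 0 <= l k <= lmax. Proof. by rewrite ltW//= l_max. Qed.

(** Mixing by [Cm] preserves column sums, so the increments telescope from the initialization
    [hy0]. *)
Lemma tracking k : one^T *m y k = one^T *m reg_map (l k) (x k).
Proof.
elim: k => [|k IH]; first by rewrite hy0.
by rewrite hy mulmxDr mulmxA hCcol mulmxBr IH addrC subrK.
Qed.

Lemma dist_opt_le k : enorm (x k - one *m xk k) <= e2 k + o * e1 k.
Proof.
rewrite -(subrKA (one *m xb k)); apply: le_trans (enormD _ _) _.
by rewrite lerD// -mulmxBr enorm_mulmx.
Qed.

Definition ybar_gain : R := mR^-1 * (enorm one^T * Lb * (1 + o)).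

Lemma ybar_gain_ge0 : 0 <= ybar_gain.
Proof.
rewrite mulr_ge0 ?invr_ge0 ?(ltW mR0)// !mulr_ge0 ?enorm_ge0 ?(ltW Lb0)//.
by rewrite addr_ge0 ?enorm_ge0.
Qed.

(** The tracked sum vanishes at [xk k], so [yb] is a difference of values of a Lipschitz map and is
    bounded by the errors with no additive constant. *)
Lemma ybar_le k : enorm (yb k) <= ybar_gain * (e1 k + e2 k).
Proof.
rewrite tracking enormZ ger0_norm ?invr_ge0 ?(ltW mR0)// /ybar_gain -[leRHS]mulrA.
rewrite ler_wpM2l ?invr_ge0 ?(ltW mR0)//.
rewrite -[one^T *m _]subr0 -(xk_zero k) -mulmxBr.
apply: le_trans (enorm_mulmx _ _) _; rewrite -!mulrA ler_wpM2l ?enorm_ge0//.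
apply: le_trans (reg_map_lip _ _ _ (l01 k)) _; rewrite ler_pM2l//.
apply: le_trans (dist_opt_le k) _.
have := enorm_ge0 one; have := enorm_ge0 (xb k - xk k).
have := mxnorm_ge0 NR (x k - one *m xb k) => a b c.
have := mulr_ge0 c a; lra.
Qed.

Definition y_gain : R := 1 + enorm v * ybar_gain.

Lemma y_gain_ge0 : 0 <= y_gain.
Proof. by rewrite addr_ge0// mulr_ge0 ?enorm_ge0 ?ybar_gain_ge0. Qed.

Lemma y_le k : enorm (y k) <= y_gain * (e1 k + e2 k + e3 k).
Proof.
rewrite -[y k](subrK (v *m yb k)); apply: le_trans (enormD _ _) _.
have h1 := enorm_le_NC (y k - v *m yb k).
have h2 := enorm_mulmx v (yb k).
have h3 : enorm v * enorm (yb k) <= enorm v * (ybar_gain * (e1 k + e2 k)).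
  by rewrite ler_wpM2l ?enorm_ge0// ybar_le.
have h4 : 0 <= enorm v * ybar_gain * e3 k.
  by rewrite mulr_ge0 ?mxnorm_ge0// mulr_ge0 ?enorm_ge0 ?ybar_gain_ge0.
have := enorm_ge0 (xb k - xk k).
have := mxnorm_ge0 NR (x k - one *m xb k).
by rewrite subrK /y_gain; lra.
Qed.

Lemma step_le k : enorm (D k *m y k) <= g k * (y_gain * (e1 k + e2 k + e3 k)).
Proof.
apply: (@le_trans _ _ (g k * enorm (y k))).
  by apply: enorm_diag_mulmx => //; exact: ltW.
by rewrite ler_pM2l// y_le.
Qed.

Lemma e2_rec k : e2 k.+1 <=
  (1 - q) * e2 k + KR * y_gain * g k * (e1 k + e2 k + e3 k).
Proof.
have /andP[q0 q1] := q01; have p0 : 0 <= 1 - q by rewrite subr_ge0.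
rewrite hx consensus_x.
apply: le_trans (mxnorm_mulmx _ hNR _ _ _ p0 SR_contr) _.
have h1 := mxnormD _ hNR (x k - one *m xb k) (- (D k *m y k)).
have h2 := NR_le_enorm (- (D k *m y k)); rewrite enormN in h2.
have h3 : KR * enorm (D k *m y k) <= KR * (g k * (y_gain * (e1 k + e2 k + e3 k))).
  by rewrite ler_wpM2l// step_le.
apply: (@le_trans _ _ ((1 - q) * (e2 k + KR * y_gain * g k * (e1 k + e2 k + e3 k)))).
  by rewrite ler_wpM2l//; lra.
rewrite mulrDr lerD2l ler_piMl//; last by lra.
rewrite mulr_ge0 ?addr_ge0 ?enorm_ge0 ?mxnorm_ge0//.
by rewrite mulr_ge0 ?(ltW (g0 k))// mulr_ge0 ?y_gain_ge0.
Qed.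

(** [Rm - 1] annihilates consensus, so mixing moves the iterates only by a multiple of [e2]. This
    term lacks a factor [g] and is the source of the one-way coupling from [e2] to [e3]. *)
Lemma x_diff_le k : enorm (x k.+1 - x k) <=
  enorm (Rm - 1%:M) * e2 k + enorm Rm * y_gain * g k * (e1 k + e2 k + e3 k).
Proof.
have -> : x k.+1 - x k = (Rm - 1%:M) *m (x k - one *m xb k) - Rm *m (D k *m y k).
  have Z : (Rm - 1%:M) *m (one *m xb k) = 0.
    by rewrite mulmxA mulmxBl hRrow mul1mx subrr mul0mx.
  by rewrite hx [in RHS]mulmxBr Z subr0 mulmxBl mul1mx mulmxBr addrAC.
apply: le_trans (enormB _ _) _; apply: lerD; apply: le_trans (enorm_mulmx _ _) _.
  by rewrite ler_wpM2l ?enorm_ge0.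
by rewrite -!mulrA ler_wpM2l ?enorm_ge0// mulrCA step_le.
Qed.

Definition grad_gain : R := Lg * (1 + o + o * P) + enorm (stack gf (one *m xs)).

(** The local gradients need not vanish at [xs], hence the additive 1, which later multiplies the
    parameter drift [h]. [P] enters as the distance from the path to [xs]. *)
Lemma grad_le k : enorm (stack gf (x k)) <= grad_gain * (1 + e1 k + e2 k).
Proof.
rewrite -[stack gf (x k)](subrK (stack gf (one *m xs))).
apply: le_trans (enormD _ _) _.
have h1 := stack_lip _ _ (x k) (one *m xs) (ltW Lg0) g_lip.
have h2 : enorm (x k - one *m xs) <= e2 k + o * e1 k + o * P.
  rewrite -(subrKA (one *m xk k)); apply: le_trans (enormD _ _) _.
  rewrite lerD ?dist_opt_le// -mulmxBr; apply: le_trans (enorm_mulmx _ _) _.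
  by rewrite ler_wpM2l ?enorm_ge0.
have h3 : Lg * enorm (x k - one *m xs) <= Lg * (e2 k + o * e1 k + o * P).
  by rewrite ler_pM2l.
have a1 := enorm_ge0 (xb k - xk k).
have a2 := mxnorm_ge0 NR (x k - one *m xb k).
have o0 := enorm_ge0 one; have s0 := enorm_ge0 (stack gf (one *m xs)).
set E1 := e1 k in h3 a1 *; set E2 := e2 k in h3 a2 *.
set O := o in h3 o0 *; set S := enorm (stack gf (one *m xs)) in s0 *.
have b1 : 0 <= S * (E1 + E2) by rewrite mulr_ge0// addr_ge0.
have b2 : 0 <= Lg * (1 + E1 + O * E2 + O * P * (E1 + E2) + O).
  by rewrite !mulr_ge0// ?addr_ge0 ?mulr_ge0 ?addr_ge0// ltW.
by rewrite /grad_gain -/O -/S; lra.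
Qed.

Lemma reg_map_diff_le k : enorm (reg_map (l k.+1) (x k.+1) - reg_map (l k) (x k)) <=
  Lb * enorm (x k.+1 - x k) + lmax * h k * (grad_gain * (1 + e1 k + e2 k)).
Proof.
rewrite -(subrKA (reg_map (l k.+1) (x k))); apply: le_trans (enormD _ _) _.
apply: lerD; first exact: reg_map_lip.
rewrite !reg_mapE opprD addrACA subrr add0r -scalerBl enormZ.
by rewrite ler_pM ?enorm_ge0// grad_le.
Qed.

Local Notation CI := (enorm (1%:M - mR^-1 *: (v *m one^T))).

Lemma e3_rec k : e3 k.+1 <=
  (1 - q) * e3 k + KC * CI * Lb * enorm (Rm - 1%:M) * e2 k
  + KC * CI * Lb * enorm Rm * y_gain * g k * (e1 k + e2 k + e3 k)
  + KC * CI * lmax * grad_gain * h k * (1 + e1 k + e2 k).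
Proof.
have /andP[q0 q1] := q01; have p0 : 0 <= 1 - q by rewrite subr_ge0.
rewrite hy consensus_y.
apply: le_trans (mxnormD _ hNC _ _) _.
have h1 := mxnorm_mulmx _ hNC _ _ (y k - v *m yb k) p0 SC_contr.
set W := _ *m (reg_map _ _ - _).
have h2 : mxnorm NC W <= KC * (CI * (Lb * enorm (x k.+1 - x k) +
   lmax * h k * (grad_gain * (1 + e1 k + e2 k)))).
  apply: le_trans (NC_le_enorm _) _; rewrite ler_wpM2l//.
  apply: le_trans (enorm_mulmx _ _) _; rewrite ler_wpM2l ?enorm_ge0//.
  exact: reg_map_diff_le.
have h3 : KC * CI * Lb * enorm (x k.+1 - x k) <= KC * CI * Lb *
    (enorm (Rm - 1%:M) * e2 k + enorm Rm * y_gain * g k * (e1 k + e2 k + e3 k)).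
  rewrite ler_wpM2l ?x_diff_le// !mulr_ge0 ?enorm_ge0//; exact: ltW.
by move: h1 h2 h3; lra.
Qed.

Local Notation alpha k := ((mR^-1 *: (u^T *m D k *m v)) 0 0).
Definition alpha_gain : R := mR^-1 * (enorm u^T * enorm v).
(** Lipschitz constant of the summed map at consensus, [z |-> one^T *m reg_map l (one *m z)]. *)
Definition sum_lip : R := enorm one^T * Lb * o.

Lemma alpha_le k : alpha k <= alpha_gain * g k.
Proof.
apply: le_trans (ler_norm _) _; apply: le_trans (ler_enorm _ _ _) _.
rewrite enormZ ger0_norm ?invr_ge0 ?(ltW mR0)// /alpha_gain -!mulrA.
rewrite ler_wpM2l ?invr_ge0 ?(ltW mR0)// -mulmxA.
apply: le_trans (enorm_mulmx _ _) _; rewrite ler_wpM2l ?enorm_ge0// mulrC.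
by apply: enorm_diag_mulmx => //; exact: ltW.
Qed.

(** The part of [y] along [v] acts as a step of length [alpha / m] on the summed map. The terms are
    that step taken at consensus, the errors due to disagreement in [x] and in [y], and the motion
    of the target. *)
Lemma xbar_next k : xb k.+1 - xk k.+1 =
  (xb k - xk k - (alpha k / mR) *: (one^T *m reg_map (l k) (one *m xb k)))
  - (alpha k / mR) *: (one^T *m (reg_map (l k) (x k) - reg_map (l k) (one *m xb k)))
  - mR^-1 *: (u^T *m (D k *m (y k - v *m yb k))) - (xk k.+1 - xk k).
Proof.
have E : mR^-1 *: (u^T *m (D k *m (v *m yb k))) = (alpha k / mR) *: (one^T *m y k).
  rewrite !mulmxA mxE; set A := _ *m D k *m v.
  by rewrite [A in LHS]mx11_scalar mul_scalar_mx !scalerA.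
have -> : xb k.+1 = xb k - mR^-1 *: (u^T *m (D k *m (y k - v *m yb k)))
    - (alpha k / mR) *: (one^T *m reg_map (l k) (x k)).
  rewrite hx mulmxA hu -tracking -E mulmxBr scalerBr -addrA -opprD; congr (_ - _).
  by rewrite -scalerDr -mulmxDr -mulmxDr subrK.
rewrite [one^T *m (_ - _)]mulmxBr [_ *: (_ *m _ - _ *m _)]scalerBr.
set T1 := _ *: (_ *m reg_map _ (x k)); set T2 := _ *: (_ *m reg_map _ (one *m _)).
set S1 := xb k; set S2 := mR^-1 *: _.
by apply/rowP => i; rewrite !mxE; ring.
Qed.

(** The two smallness conditions are those of [strongly_monotone_step] for the modulus [mu * l k],
    with [alpha] replaced by its upper bound; its lower bound [theta * g] gives the contraction
    rate. *)
Lemma e1_rec k :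
  g k * (alpha_gain / mR * sum_lip ^+ 2) <= mu * l k ->
  g k * (alpha_gain / mR * (mu * lmax)) <= 1 ->
  e1 k.+1 <= (1 - theta * mu / (2 * mR) * (g k * l k)) * e1 k
    + alpha_gain / mR * enorm one^T * Lb * g k * e2 k + mR^-1 * enorm u^T * g k * e3 k
    + P * h k.
Proof.
move=> small1 small2.
have al0 : 0 <= alpha k by rewrite (le_trans _ (alpha_ge k))// mulr_ge0 ?ltW.
have s0 : 0 <= alpha k / mR by rewrite divr_ge0// ltW.
have sle : alpha k / mR <= alpha_gain / mR * g k.
  by rewrite mulrAC ler_pM2r ?invr_gt0// alpha_le.
have sge : theta * g k / mR <= alpha k / mR by rewrite ler_pM2r ?invr_gt0.
rewrite xbar_next.
set s := alpha k / mR in s0 sle sge *.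
set W1 := xb k - xk k - s *: _; set W2 := s *: _; set W3 := mR^-1 *: _.
have t1 : enorm W1 <= (1 - s * (mu * l k) / 2) * e1 k.
  apply: (@strongly_monotone_step _ _ _ _ (mu * l k) sum_lip) => //.
  - by rewrite !mulr_ge0 ?enorm_ge0// ltW.
  - by have := T_mono k (xb k) (xk k); rewrite xk_zero subr0.
  - rewrite -[one^T *m _]subr0 -(xk_zero k) -mulmxBr.
    apply: le_trans (enorm_mulmx _ _) _; rewrite /sum_lip -!mulrA ler_wpM2l ?enorm_ge0//.
    apply: le_trans (reg_map_lip _ _ _ (l01 k)) _; rewrite ler_pM2l// -mulmxBr.
    exact: enorm_mulmx.
  - apply: le_trans small1; rewrite [leRHS]mulrA [g k * _]mulrC ler_wpM2r ?sqr_ge0//.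
  - apply: le_trans small2; rewrite [leRHS]mulrA [g k * _]mulrC ler_pM//.
      by rewrite mulr_ge0// ltW.
    by rewrite ler_pM2l.
have t2 : enorm W2 <= alpha_gain / mR * g k * (enorm one^T * (Lb * e2 k)).
  rewrite enormZ ger0_norm// ler_pM ?enorm_ge0//.
  apply: le_trans (enorm_mulmx _ _) _; rewrite ler_wpM2l ?enorm_ge0//.
  apply: le_trans (reg_map_lip _ _ _ (l01 k)) _.
  by rewrite ler_pM2l// enorm_le_NR.
have t3 : enorm W3 <= mR^-1 * (enorm u^T * (g k * e3 k)).
  rewrite enormZ ger0_norm ?invr_ge0 ?(ltW mR0)//.
  rewrite ler_wpM2l ?invr_ge0 ?(ltW mR0)//.
  apply: le_trans (enorm_mulmx _ _) _; rewrite ler_wpM2l ?enorm_ge0//.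
  apply: (@le_trans _ _ (g k * enorm (y k - v *m yb k))).
    by apply: enorm_diag_mulmx => //; exact: ltW.
  by rewrite ler_pM2l.
have t4 := xk_drift k.
have t5 : (1 - s * (mu * l k) / 2) * e1 k <=
    (1 - theta * mu / (2 * mR) * (g k * l k)) * e1 k.
  rewrite ler_wpM2r ?enorm_ge0// lerD2l lerN2.
  have -> : theta * mu / (2 * mR) * (g k * l k) = theta * g k / mR * (mu * l k) / 2.
    by field; rewrite mRn0.
  by rewrite ler_pM2r ?invr_gt0// ler_pM2r// mulr_gt0.
apply: le_trans (enormB _ _) _.
have u1 := enormB (W1 - W2) W3; have u2 := enormB W1 W2.
by move: t1 t2 t3 t4 t5 u1 u2; lra.
Qed.

Lemma error_rates (w : nat -> R) :
  (forall k, 0 < w k) -> (forall k, g k.+1 <= g k) ->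
  (forall k, h k = w k * (g k * l k)) ->
  (forall k, w k - w k.+1 <= h k * w k) ->
  (forall e : R, 0 < e -> \forall k \near \oo,
     [/\ g k <= e * l k, w k <= e & l k <= e]) ->
  exists E, 0 <= E /\
    forall k, [/\ e1 k <= E * w k, e2 k <= E * w k & e3 k <= E * w k].
Proof.
move=> w0 gdec hE hw small.
have Ca0 : 0 <= alpha_gain.
  by rewrite mulr_ge0 ?mulr_ge0 ?enorm_ge0// invr_ge0 ltW.
have LT0 : 0 <= sum_lip by rewrite !mulr_ge0 ?enorm_ge0// ltW.
have Cg0 : 0 <= grad_gain.
  rewrite addr_ge0 ?enorm_ge0// mulr_ge0 ?(ltW Lg0)//.
  by rewrite !addr_ge0 ?mulr_ge0 ?enorm_ge0.
pose K1 := alpha_gain / mR * sum_lip ^+ 2; pose K2 := alpha_gain / mR * (mu * lmax).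
have CamR0 : 0 <= alpha_gain / mR by rewrite divr_ge0// ltW.
have K10 : 0 <= K1 by rewrite mulr_ge0// sqr_ge0.
have K20 : 0 <= K2 by rewrite mulr_ge0// mulr_ge0// ltW.
pose A1 := KR * y_gain; pose A2 := alpha_gain / mR * enorm one^T * Lb.
pose A3 := mR^-1 * enorm u^T; pose A4 := KC * CI * Lb * enorm (Rm - 1%:M).
pose A5 := KC * CI * Lb * enorm Rm * y_gain; pose A6 := KC * CI * lmax * grad_gain.
have B0 : 0 <= KC * CI by rewrite mulr_ge0 ?enorm_ge0.
have B1 : 0 <= KC * CI * Lb by rewrite mulr_ge0// ltW.
have A10 : 0 <= A1 by rewrite mulr_ge0// y_gain_ge0.
have A20 : 0 <= A2 by rewrite mulr_ge0 ?(ltW Lb0)// mulr_ge0 ?enorm_ge0.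
have A30 : 0 <= A3 by rewrite mulr_ge0 ?enorm_ge0// invr_ge0 ltW.
have A40 : 0 <= A4 by rewrite mulr_ge0 ?enorm_ge0.
have A50 : 0 <= A5 by rewrite mulr_ge0 ?y_gain_ge0// mulr_ge0 ?enorm_ge0.
have A60 : 0 <= A6 by rewrite mulr_ge0// mulr_ge0// ltW.
have [C [C0 CP [C1 C2 C3] [C4 C5 C6]]] : exists C : R,
    [/\ 0 < C, P <= C, [/\ A1 <= C, A2 <= C & A3 <= C] & [/\ A4 <= C, A5 <= C & A6 <= C]].
  exists (1 + A1 + A2 + A3 + A4 + A5 + A6 + P).
  move: A1 A2 A3 A4 A5 A6 A10 A20 A30 A40 A50 A60 P P0 {CamR0 Ca0 K10 K20}.
  by move=> *; split; [lra|lra|split; lra|split; lra].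
apply: (@coupled_recursion R _ _ _ g l h w (theta * mu / (2 * mR)) C q) => //.
- by rewrite divr_gt0 ?mulr_gt0.
- by move=> k; exact: enorm_ge0.
- by move=> k; exact: mxnorm_ge0.
- by move=> k; exact: mxnorm_ge0.
(* Both conditions of [e1_rec] follow from [g <= e * l], the second together with [l <= lmax]; the
   added 1 keeps the denominators positive. *)
- have d1 : 0 < mu / (K1 + 1) by rewrite divr_gt0// ltr_pwDr.
  have d2 : 0 < 1 / (K2 * lmax + 1).
    by rewrite divr_gt0// ltr_pwDr// mulr_ge0// ltW.
  have := small _ d1; have := small _ d2; apply: filterS2 => k [s2 _ _] [s1 _ _].
  have lk := ltW (l0 k).
  have c1 : g k * K1 <= mu * l k.
    apply: (@le_trans _ _ (g k * (K1 + 1))); first by rewrite ler_pM2l// lerDl.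
    by rewrite -ler_pdivlMr ?ltr_pwDr// mulrAC.
  have c2 : g k * K2 <= 1.
    apply: (@le_trans _ _ (1 / (K2 * lmax + 1) * lmax * K2)).
      rewrite ler_wpM2r// (le_trans s2)// ler_pM2l//.
    rewrite -mulrA div1r ler_pdivrMl; last by rewrite ltr_pwDr// mulr_ge0// ltW.
    by rewrite mulr1 mulrC lerDl.
  have := e1_rec k c1 c2; rewrite -/A2 -/A3.
  have x2 : (A2 * g k) * e2 k <= C * g k * e2 k.
    by rewrite ler_wpM2r ?mxnorm_ge0// ler_pM2r.
  have x3 : (A3 * g k) * e3 k <= C * g k * e3 k.
    by rewrite ler_wpM2r ?mxnorm_ge0// ler_pM2r.
  have x4 : P * h k <= C * h k by rewrite ler_pM2r.
  by rewrite mulrDr; lra.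
- move=> k; apply: le_trans (e2_rec k) _; rewrite lerD2l.
  by rewrite ler_wpM2r ?addr_ge0 ?enorm_ge0 ?mxnorm_ge0// ler_pM2r.
- move=> k; apply: le_trans (e3_rec k) _; rewrite -/A4 -/A5 -/A6.
  rewrite !lerD ?lexx//.
  + by rewrite ler_wpM2r ?mxnorm_ge0.
  + by rewrite ler_wpM2r ?addr_ge0 ?enorm_ge0 ?mxnorm_ge0// ler_pM2r.
  + by rewrite ler_wpM2r ?addr_ge0 ?enorm_ge0 ?mxnorm_ge0// ler_pM2r.
Qed.

End one_step.

(** * Stepsizes *)

Section shifted_powers.
Context {R : realType}.

(** For a base in (0, 1] and an exponent at most 1, [(s / (s + 1)) ^ p] is at least [s / (s + 1)],
    hence at least [1 - 1 / s]. Both drift estimates of order [1 / s] rest on this. *)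
Lemma powR_succ_ge (s p : R) : 0 < s -> 0 <= p <= 1 ->
  (1 - s^-1) * (s + 1) `^ p <= s `^ p.
Proof.
move=> s0 /andP[p0 p1]; have s10 : 0 < s + 1 by rewrite addr_gt0.
have h : 1 - s^-1 <= (s / (s + 1)) `^ p.
  apply: (@le_trans _ _ (s / (s + 1))).
    have -> : s / (s + 1) = 1 - (s + 1)^-1 by field; rewrite gt_eqF.
    by rewrite lerD2l lerN2 lef_pV2 ?posrE// lerDl.
  apply: ger1_powR => //; rewrite divr_gt0//= ler_pdivrMr// mul1r lerDl.
  by [].
have -> : s `^ p = (s / (s + 1)) `^ p * (s + 1) `^ p.
  by rewrite -powRM ?divr_ge0 ?(ltW s0) ?(ltW s10)// divfK// gt_eqF.
by rewrite ler_pM2r// powR_gt0.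
Qed.

Lemma near_powR_le (Gam p e : R) : 0 < p -> 0 < Gam -> 0 < e ->
  \forall k \near \oo, ((k%:R + Gam) `^ p)^-1 <= e.
Proof.
move=> p0 G0 e0; near=> k.
have sk : 0 < k%:R + Gam by rewrite ltr_wpDl.
rewrite -[leRHS]invrK lef_pV2 ?posrE ?powR_gt0 ?invr_gt0//.
have -> : e^-1 = (e^-1 `^ p^-1) `^ p.
  by rewrite -powRrM mulVf ?gt_eqF// powRr1// invr_ge0 ltW.
apply: ge0_ler_powR; rewrite ?nnegrE ?powR_ge0 ?(ltW p0) ?(ltW sk)//.
apply: (@le_trans _ _ k%:R); last by rewrite lerDl ltW.
near: k; exact: nbhs_infty_ger.
Unshelve. all: end_near. Qed.

Lemma inv_powR_drift (s p : R) : 0 < s -> 0 <= p <= 1 ->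
  (s `^ p)^-1 - ((s + 1) `^ p)^-1 <= s^-1 * (s `^ p)^-1.
Proof.
move=> s0 p01; have := powR_succ_ge s p s0 p01.
have s10 : 0 < s + 1 by rewrite addr_gt0.
have x0 : 0 < s `^ p by rewrite powR_gt0.
have y0 : 0 < (s + 1) `^ p by rewrite powR_gt0.
rewrite -ler_pdivlMr// => h.
have : (1 - s^-1) / s `^ p <= ((s + 1) `^ p)^-1.
  by rewrite ler_pdivrMr// mulrC.
lra.
Qed.

Lemma inv_powR_rel_drift (lam s p : R) : 0 < lam -> 0 < s -> 0 <= p <= 1 ->
  `|1 - (lam / (s + 1) `^ p) / (lam / s `^ p)| <= s^-1.
Proof.
move=> l0 s0 p01; have h := powR_succ_ge s p s0 p01.
have s10 : 0 < s + 1 by rewrite addr_gt0.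
have x0 : 0 < s `^ p by rewrite powR_gt0.
have y0 : 0 < (s + 1) `^ p by rewrite powR_gt0.
have -> : lam / (s + 1) `^ p / (lam / s `^ p) = s `^ p / (s + 1) `^ p.
  by field; rewrite !gt_eqF.
have le1 : s `^ p / (s + 1) `^ p <= 1.
  rewrite ler_pdivrMr// mul1r; case/andP: p01 => p0 _.
  by apply: ge0_ler_powR; rewrite ?nnegrE ?(ltW s0) ?(ltW s10)// lerDl.
rewrite ger0_norm ?subr_ge0//.
have : 1 - s^-1 <= s `^ p / (s + 1) `^ p by rewrite ler_pdivlMr.
lra.
Qed.

(** The drift [1 / s] divided by [gamma * lambda], which is proportional to [s ^ -(a + b)]: the
    origin of the exponent [1 - a - b] and of the weight [w]. *)
Lemma rate_weightE (ghat lam s a b : R) : 0 < ghat -> 0 < lam -> 0 < s ->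
  s^-1 / (ghat / s `^ a * (lam / s `^ b)) = (ghat * lam)^-1 / s `^ (1 - a - b).
Proof.
move=> g0 l0 s0.
have s_neq0 : s != 0 by rewrite gt_eqF.
rewrite !powRB ?s_neq0 ?implybT// powRr1 ?ltW//.
have := powR_gt0 a s0; have := powR_gt0 b s0.
move: (s `^ a) (s `^ b) => A B B0 A0; field.
by rewrite s_neq0 !gt_eqF.
Qed.

(** The stepsize ratio, the weight and the regularization decay with exponents [a - b], [1 - a - b]
    and [b], all positive. *)
Lemma near_stepsizes_small (ghat lam Gam a b e : R) :
  0 < ghat -> 0 < lam -> 0 < Gam -> 0 < b -> b < a -> a + b < 1 -> 0 < e ->
  \forall k \near \oo, [/\
    ghat / (k%:R + Gam) `^ a <= e * (lam / (k%:R + Gam) `^ b),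
    (ghat * lam)^-1 / (k%:R + Gam) `^ (1 - a - b) <= e
    & lam / (k%:R + Gam) `^ b <= e].
Proof.
move=> g0 l0 G0 b0 ba ab1 e0.
have p0 : 0 < 1 - a - b by lra.
have ab0 : 0 < a - b by rewrite subr_gt0.
have e1 : 0 < e * lam / ghat by rewrite !mulr_gt0 ?invr_gt0.
have e2 : 0 < e * (ghat * lam) by rewrite !mulr_gt0.
have e3 : 0 < e / lam by rewrite divr_gt0.
have := near_powR_le Gam _ _ p0 G0 e2; have := near_powR_le Gam _ _ b0 G0 e3.
have := near_powR_le Gam _ _ ab0 G0 e1; apply: filterS3 => k h1 h3 h2.
have s0 : 0 < k%:R + Gam by rewrite ltr_wpDl.
have s_neq0 : k%:R + Gam != 0 by rewrite gt_eqF.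
split.
- have -> : (k%:R + Gam) `^ a = (k%:R + Gam) `^ (a - b) * (k%:R + Gam) `^ b.
    by rewrite -powRD ?s_neq0 ?implybT// subrK.
  rewrite invfM !mulrA ler_pM2r ?invr_gt0 ?powR_gt0//.
  by rewrite mulrC -ler_pdivlMr.
- by rewrite mulrC -ler_pdivlMr ?invr_gt0 ?mulr_gt0// invrK.
- by rewrite mulrC -ler_pdivlMr.
Qed.

End shifted_powers.

(** * Sums of local maps and assembly of the theorem *)

Lemma enorm_sum {R : realType} {n : nat} (I : finType) (z : I -> 'rV[R]_n) :
  enorm (\sum_i z i) <= \sum_i enorm (z i).
Proof.
elim/big_rec2 : _ => [|i a b _ h]; first by rewrite enorm0.
by apply: le_trans (enormD _ _) _; rewrite lerD2l.
Qed.

Lemma lip_eucl_sum {R : realType} {m n : nat} (L : R)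
    (H : 'I_m -> 'rV[R]_n -> 'rV[R]_n) :
  (forall i, lip_eucl L (H i)) ->
  lip_eucl (m%:R * L) (fun z => \sum_(i < m) H i z).
Proof.
move=> HL z z'; rewrite -sumrB; apply: le_trans (enorm_sum _ _) _.
have -> : m%:R * L * enorm (z - z') = \sum_(i < m) L * enorm (z - z').
  by rewrite sumr_const card_ord -mulrA mulr_natl.
by apply: ler_sum => i _; exact: HL.
Qed.

(** Testing the variational inequality at [z - F z] gives [- |F z|^2 >= 0]. *)
Lemma SOL_zero {R : realType} {n : nat} (F : 'rV[R]_n -> 'rV[R]_n) z :
  SOL F z <-> F z = 0.
Proof.
split=> [/(_ (z - F z))|Fz w]; last by rewrite /dotr Fz mul0mx mxE.
rewrite addrC addKr dotrNr -sqr_enorm_row oppr_ge0 => h.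
by apply: enorm_eq0; apply/eqP; rewrite -sqrf_eq0 eq_le h sqr_ge0.
Qed.

Theorem theorem1
  (R : realType) (m n : nat) (hm : (0 < m)%N) (hn : (0 < n)%N)
  (f : 'I_m -> 'rV[R]_n -> R) (gf : 'I_m -> 'rV[R]_n -> 'rV[R]_n)
  (F : 'I_m -> 'rV[R]_n -> 'rV[R]_n)
  (muf Lf LF : R)
  (hgrad : forall i, is_C1_gradient (f i) (gf i))
  (hmuf : 0 < muf)
  (hsc : strongly_convex_eucl muf (fun x => \sum_(i < m) f i x))
  (hLfpos : 0 < Lf) (hLFpos : 0 < LF)
  (hLf : forall i, lip_eucl Lf (gf i))
  (hmon : monotone_op (fun x => \sum_(i < m) F i x))
  (hLF : forall i, lip_eucl LF (F i))
  (xstar : 'rV[R]_n)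
  (hxs_sol : SOL (fun x => \sum_(i < m) F i x) xstar)
  (hxs_min : forall y, SOL (fun x => \sum_(i < m) F i x) y ->
                \sum_(i < m) f i xstar <= \sum_(i < m) f i y)
  (xl : R -> 'rV[R]_n)
  (hxl : forall l, 0 < l ->
     \sum_(i < m) F i (xl l) + l *: \sum_(i < m) gf i (xl l) = 0)
  (Rm Cm : 'M[R]_m)
  (hRnn : forall i j, 0 <= Rm i j) (hCnn : forall i j, 0 <= Cm i j)
  (hRdiag : forall i, 0 < Rm i i) (hCdiag : forall i, 0 < Cm i i)
  (hRrow : Rm *m (const_mx 1 : 'cV[R]_m) = const_mx 1)
  (hCcol : (const_mx 1 : 'rV[R]_m) *m Cm = const_mx 1)
  (hroot : exists r, spanning_root Rm r && spanning_root Cm^T r)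
  (u v : 'cV[R]_m)
  (hunn : forall i, 0 <= u i 0) (hvnn : forall i, 0 <= v i 0)
  (hu : u^T *m Rm = u^T) (husum : \sum_(i < m) u i 0 = m%:R)
  (hv : Cm *m v = v) (hvsum : \sum_(i < m) v i 0 = m%:R)
  (NR NC : 'cV[R]_m -> R) (hNR : is_vnorm NR) (hNC : is_vnorm NC)
  (hsigR : opnorm NR (Rm - m%:R^-1 *: ((const_mx 1 : 'cV[R]_m) *m u^T)) < 1)
  (hsigC : opnorm NC (Cm - m%:R^-1 *: (v *m (const_mx 1 : 'rV[R]_m))) < 1)
  (h2R : forall p (W : 'M[R]_(m, p)), enorm W <= mxnorm NR W)
  (h2C : forall p (W : 'M[R]_(m, p)), enorm W <= mxnorm NC W)
  (dRC dC2 : R) (hdRC : 0 < dRC) (hdC2 : 0 < dC2)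
  (hRC : forall p (W : 'M[R]_(m, p)), mxnorm NR W <= dRC * mxnorm NC W)
  (hC2 : forall p (W : 'M[R]_(m, p)), mxnorm NC W <= dC2 * enorm W)
  (ghat lam Gam a b theta : R)
  (hghat : 0 < ghat) (hlam : 0 < lam) (hGam0 : 0 < Gam) (ha : 0 < a) (hb : 0 < b)
  (hab : b < a) (hab1 : a + b < 1) (hab2 : 2 * a + 3 * b < 2) (hGam1 : 1 <= Gam)
  (htheta : 0 < theta)
  (hGamtau : (4 / (ghat * lam * muf * (theta / 2))) `^ (1 / (1 - a - b)) <= Gam)
  (gamma : nat -> 'I_m -> R) (hgnn : forall k j, 0 <= gamma k j)
  (hgmax : forall k, \big[Num.max/0]_(j < m) gamma k j = ghat / (k%:R + Gam) `^ a)
  (halpha : forall k, m%:R^-1 * (\sum_(j < m) u j 0 * gamma k j * v j 0)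
                        >= theta * (ghat / (k%:R + Gam) `^ a))
  (x y : nat -> 'M[R]_(m, n))
  (hy0 : forall i, row i (y 0%N) =
      F i (row i (x 0%N)) + (lam / (0%:R + Gam) `^ b) *: gf i (row i (x 0%N)))
  (hx : forall k i, row i (x k.+1) =
      \sum_(j < m) Rm i j *: (row j (x k) - gamma k j *: row j (y k)))
  (hy : forall k i, row i (y k.+1) =
      \sum_(j < m) Cm i j *: row j (y k)
      + F i (row i (x k.+1)) + (lam / (k.+1%:R + Gam) `^ b) *: gf i (row i (x k.+1))
      - F i (row i (x k)) - (lam / (k%:R + Gam) `^ b) *: gf i (row i (x k))) :
  let one : 'cV[R]_m := const_mx 1 in
  let mR : R := m%:R in
  let lamk (k : nat) : R := lam / (k%:R + Gam) `^ b in
  let xbar (k : nat) : 'rV[R]_n := mR^-1 *: (u^T *m x k) in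
  let ybar (k : nat) : 'rV[R]_n := mR^-1 *: (one^T *m y k) in
  let sigR := opnorm NR (Rm - mR^-1 *: (one *m u^T)) in
  let sigC := opnorm NC (Cm - mR^-1 *: (v *m one^T)) in
  let c0 := dC2 * opnorm NC (1%:M - mR^-1 *: (v *m one^T)) in
  let L0 := LF + lamk 0%N * Lf in
  let Lam0 := `|1 - lamk 1%N / lamk 0%N| in
  let uTv := (u^T *m v) 0 0 in
  let thbar := uTv / mR in
  let nR2 := specnorm Rm in
  let nRI2 := specnorm (Rm - 1%:M) in
  let nv2 := enorm v in
  let nu2 := enorm u in
  let nvR := NR v in
  let sm := Num.sqrt mR in
  let Gh2 := Num.max ((L0 * ghat * uTv / mR) `^ (1 / a))
                     ((ghat * uTv * L0 ^+ 2 / (mR * muf * lam)) `^ (1 / (a - b))) in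
  let c1 := (2^-1 * muf * thbar * lam) * sigR * dRC * c0 * L0 * nR2 * nv2 * (L0 / sm)
          + (thbar * L0 / sm) * sigR * dRC * c0 * L0 * nR2 * nv2 * L0
          + (nu2 / mR) * sigR * L0 * nvR * c0 * L0 * nR2 * nv2 * (L0 / sm) in
  let c2 := (2^-1 * muf * thbar * lam) * sigR * dRC * c0 * L0 * (nRI2 + 2 * Lam0)
          + (1 - sigC) / 2 * (thbar * L0 / sm) * sigR * L0 * nvR
          + (thbar * L0 / sm) * sigR * dRC * c0 * L0 * (2 * sm * Lam0)
          + (nu2 / mR) * sigR * L0 * nvR * c0 * L0 * (nRI2 + 2 * Lam0)
          + (1 - sigR) / 2 * c0 * L0 * nR2 * nv2 * L0 * (nu2 / mR) in
  let c3 := 8^-1 * muf * theta * (1 - sigR) * (1 - sigC) in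
  let c4 := (1 - sigR) / 2 * c0 * L0 * sm * (nu2 / mR) in
  let Gh3 := Num.max Gh2 (Num.max
       (((muf * lam * ghat * uTv + 2 * ghat * nvR * L0) / ((1 - sigR) * sm)) `^ (1 / a))
     (Num.max
       (((muf * lam * ghat * uTv + 2 * ghat * c0 * L0 * nR2) / (1 - sigC)) `^ (1 / a))
     (Num.max
       ((2^-1 * muf * lam * ghat * uTv / mR) `^ (1 / (a + b)))
     (Num.max
       ((3 * c1 * ghat ^+ 2 / (c3 * lam)) `^ (1 / (2 * a - b)))
     (Num.max
       ((3 * c2 * ghat / (c3 * lam)) `^ (1 / (a - b)))
       ((3 * c4 / (c3 * lam)) `^ (1 / (1 - b)))))))) in
  Gh3 <= Gam ->
  exists M BF : R, 0 < M /\ 0 < BF /\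
    let Theta := Num.max 1 (Num.max (sigR * ghat * L0 * nvR)
                   (c0 * L0 * (ghat * nR2 * nv2 * L0 + sm * Lam0 + muf * c0 * BF / M)))
                 * (Num.sqrt 3 * M / muf) in
    let Delta1 := Num.sqrt (enorm (xbar 1%N - xl (lamk 0%N)) ^+ 2
                           + mxnorm NR (x 1%N - one *m xbar 1%N) ^+ 2
                           + mxnorm NC (y 1%N - v *m ybar 1%N) ^+ 2) in
    let Bsc := Num.max ((Gam + 1) `^ (1 - a - b) * Delta1)
                       (4 * Theta / (muf * lam * ghat * theta)) in
    [/\ forall k : nat, (1 <= k)%N ->
          mxnorm NR (x k.+1 - one *m xbar k.+1) <= Bsc / (k%:R + Gam - 1) `^ (1 - a - b),
        forall k : nat, (1 <= k)%N ->
          mxnorm NC (y k.+1 - v *m ybar k.+1) <= Bsc / (k%:R + Gam - 1) `^ (1 - a - b)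
      & xbar k @[k --> \oo] --> xstar].
Proof.
move=> one mR lamk xbar ybar sigR sigC c0 L0 Lam0 uTv thbar nR2 nRI2 nv2 nu2 nvR
  sm Gh2 c1 c2 c3 c4 Gh3 _.
pose s k : R := k%:R + Gam; pose g k := ghat / s k `^ a.
pose p := 1 - a - b; pose w k := (ghat * lam)^-1 / s k `^ p.
have s0 k : 0 < s k by rewrite ltr_wpDl.
have sS k : s k.+1 = s k + 1 by rewrite /s -natr1 addrAC.
have lamkE k : lamk k = lam / s k `^ b by [].
have p01 : 0 < p <= 1 by rewrite /p; lra.
have b01 : 0 <= b <= 1 by lra.
have lam0 k : 0 < lamk k by rewrite lamkE divr_gt0// powR_gt0.
have g0 k : 0 < g k by rewrite divr_gt0// powR_gt0.
have w0 k : 0 < w k by rewrite divr_gt0 ?powR_gt0// invr_gt0 mulr_gt0.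
have powS q k : 0 <= q -> s k `^ q <= s k.+1 `^ q.
  by move=> q0; apply: ge0_ler_powR; rewrite ?nnegrE ?(ltW (s0 _))// sS lerDl.
have lamkS k : lamk k.+1 <= lamk k.
  by rewrite !lamkE ler_pM2l// lef_pV2 ?posrE ?powR_gt0// powS// ltW.
have gS k : g k.+1 <= g k.
  by rewrite ler_pM2l// lef_pV2 ?posrE ?powR_gt0// powS// ltW.
have lamk_dec j k : (j <= k)%N -> lamk k <= lamk j.
  move=> /subnKC <-; elim: (k - j)%N => [|i IH]; first by rewrite addn0.
  by rewrite addnS (le_trans (lamkS _)).
have drift k : `|1 - lamk k.+1 / lamk k| <= (s k)^-1.
  by rewrite !lamkE sS; apply: inv_powR_rel_drift.
have small e : 0 < e -> \forall k \near \oo,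
    [/\ g k <= e * lamk k, w k <= e & lamk k <= e].
  exact: near_stepsizes_small.
pose f' z := \sum_(i < m) f i z; pose gf' z := \sum_(i < m) gf i z.
pose F' z := \sum_(i < m) F i z.
have hf z z' : f' z + dotr (gf' z) (z' - z) + muf / 2 * enorm (z' - z) ^+ 2 <= f' z'.
  by apply: strongly_convex_first_order => //; exact: is_derive_sum_gradient.
have Fxs : F' xstar = 0 by apply/SOL_zero.
have F'_lip : lip_eucl (m%:R * LF) F' by exact: lip_eucl_sum.
have gf'_lip : lip_eucl (m%:R * Lf) gf' by exact: lip_eucl_sum.
have xs_min z : F' z = 0 -> f' xstar <= f' z by move/SOL_zero; exact: hxs_min.
have xl_lim : enorm (xl (lamk k) - xstar) @[k --> \oo] --> (0 : R).
  apply: (xl_cvg f' F' gf' muf (m%:R * LF) (m%:R * Lf)) => //.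
  apply/cvgrPdist_le => e e0; apply: filterS (small _ e0) => k [_ _].
  by rewrite sub0r normrN gtr0_norm.
pose P0 := xl_grad_bound gf' muf (m%:R * Lf) xstar / muf.
have P00 : 0 <= P0 by rewrite divr_ge0 ?(ltW hmuf)// xl_grad_bound_ge0.
(* One constant must bound both the distance from the path to [xstar] and the drift coefficient of
   the path, hence the sum. *)
pose P := enorm (gf' xstar) / muf + P0.
have Q00 : 0 <= enorm (gf' xstar) / muf by rewrite divr_ge0 ?(ltW hmuf)// enorm_ge0.
have mR0 : 0 < mR by rewrite ltr0n.
have hNR2 z : NR z <= dRC * dC2 * enorm z.
  rewrite -(mxnorm_col _ hNR) -mulrA; apply: le_trans (hRC _ _) _.
  by rewrite ler_pM2l.
have hNC2 z : NC z <= dC2 * enorm z by rewrite -(mxnorm_col _ hNC).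
(* The smaller contraction gap serves both norms; the entry 1 provides [q <= 1]. *)
pose q := Num.min 1 (Num.min (1 - sigR) (1 - sigC)).
have sR1 : sigR < 1 by [].
have sC1 : sigC < 1 by rewrite /sigC /one trmx_const.
have q01 : 0 < q <= 1.
  by rewrite /q !lt_min ltr01 !subr_gt0 sR1 sC1 ge_min lexx.
have qR : sigR <= 1 - q.
  by rewrite lerBrDr -lerBrDl /q !ge_min lexx !orbT.
have qC : sigC <= 1 - q.
  by rewrite lerBrDr -lerBrDl /q !ge_min lexx !orbT.
have [E [E0 HE]] : exists E, 0 <= E /\ forall k,
    [/\ enorm (xbar k - xl (lamk k)) <= E * w k,
        mxnorm NR (x k - one *m xbar k) <= E * w k
      & mxnorm NC (y k - v *m ybar k) <= E * w k].
  (* Here [lmax] is [lamk 0], the largest regularization, and [h] is [1 / s]. [NR] is compared with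
     the Euclidean norm through [NC], whence [dRC * dC2]. *)
  apply: (@error_rates R m n hm F gf LF Lf hLFpos hLfpos hLF hLf Rm Cm u v
    _ _ _ _ _ _ (lamk 0%N) x y (fun k => \row_j gamma k j) g lamk
    (fun k => (s k)^-1) (fun k => xl (lamk k)) xstar P muf theta q
    _ _ _ _ _ _ _ _ _ _ _ _ _ _ _ _ _ NR NC (dRC * dC2) dC2) => //.
  - by rewrite trmx_const.
  - apply/matrixP => i j; rewrite !ord1 !mxE mulr1n -husum.
    by apply: eq_bigr => k _; rewrite !mxE mulr1.
  - apply/matrixP => i j; rewrite !ord1 !mxE mulr1n -hvsum.
    by apply: eq_bigr => k _; rewrite !mxE mul1r.
  - move=> k; apply/row_matrixP => i; rewrite hx row_mul mulmx_sum_row.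
    apply: eq_bigr => j _; rewrite !mxE; congr (_ *: _).
    by rewrite linearB/= row_mul row_diag_mx -scalemxAl -rowE mxE.
  - by apply/row_matrixP => i; rewrite hy0 /reg_map row_stack.
  - move=> k; apply/row_matrixP => i; rewrite hy !linearD/= linearN/= /reg_map !row_stack.
    rewrite row_mul mulmx_sum_row opprD !addrA; congr (_ + _ + _ - _ - _).
    by apply: eq_bigr => j _; rewrite !mxE.
  - move=> k j; rewrite mxE hgnn/= /g -hgmax; exact: le_bigmax.
  - by move=> k; rewrite invr_gt0.
  - by move=> k; exact: lamk_dec.
  - move=> k; have -> : lamk k.+1 - lamk k = - (lamk k * (1 - lamk k.+1 / lamk k)).
      by field; rewrite gt_eqF.
    rewrite normrN normrM gtr0_norm//; apply: ler_pM => //; first exact: ltW.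
    exact: lamk_dec.
  - by rewrite addr_ge0.
  - move=> k z z'; rewrite !oneT_reg_map// -/(F' z) -/(F' z') -/(gf' z) -/(gf' z').
    rewrite opprD addrACA -scalerBr dotrDl dotrZl.
    have t1 := hmon z z'; have t2 := gradient_strongly_monotone f' gf' muf hf z z'.
    rewrite -/(F' z) -/(F' z') in t1.
    have : lamk k * (muf * enorm (z - z') ^+ 2) <= lamk k * dotr (gf' z - gf' z') (z - z').
      by rewrite ler_pM2l.
    by move: t1; lra.
  - by move=> k; rewrite oneT_reg_map// hxl.
  - move=> k; apply: (@le_trans _ _ (enorm (gf' xstar) / muf)); last by rewrite lerDl.
    exact: (xl_dist_le f' F').
  - move=> k; apply: le_trans (xl_lipschitz f' F' gf' muf (m%:R * Lf) xstar xl
      hmuf hf hmon gf'_lip Fxs hxl _ _ (lam0 k) (lam0 k.+1)) _.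
    rewrite mulrC; apply: ler_pM => //; by rewrite lerDr.
  - move=> k; apply: le_trans (halpha k) _; rewrite mxE ler_pM2l ?invr_gt0//.
    rewrite mxE le_eqVlt; apply/orP; left; apply/eqP; apply: eq_bigr => j _.
    by rewrite mul_mx_diag !mxE.
  - by rewrite mulr_ge0// ltW.
  - exact: ltW.
  - by move=> W; rewrite -mulrA; apply: le_trans (hRC _ _) _; rewrite ler_pM2l.
  - move=> z; apply: (@le_trans _ _ (sigR * NR z)).
      apply: (opnorm_bound _ hNR (dRC * dC2)) => // t.
      by rewrite -(mxnorm_col _ hNR).
    by rewrite ler_wpM2r// vnorm_ge0.
  - move=> z; apply: (@le_trans _ _ (sigC * NC z)).
      apply: (opnorm_bound _ hNC dC2) => // t.
      by rewrite -(mxnorm_col _ hNC).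
    by rewrite ler_wpM2r// vnorm_ge0.
  - move=> k; rewrite /w -rate_weightE//; rewrite -/(g k) -/(lamk k) divfK//.
    by rewrite mulf_neq0// gt_eqF.
  - move=> k; rewrite /w -mulrBr mulrCA ler_pM2l ?invr_gt0 ?mulr_gt0// sS.
    by apply: inv_powR_drift => //; case/andP: p01 => /ltW -> ->.
have p0 : 0 < p by case/andP: p01.
pose Q := muf * lam * ghat * theta; pose E' := E * (ghat * lam)^-1.
have Q0 : 0 < Q by rewrite /Q !mulr_gt0.
have E'0 : 0 <= E' by rewrite mulr_ge0// invr_ge0 mulr_ge0// ltW.
(* [Q] is the denominator in [Bsc]. The entry 1 of the maximum in [Theta] gives
   [Theta >= sqrt 3 * (E' + 1) * Q], hence [4 * Theta / Q >= E'], whatever the value of the other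
   entries. *)
exists ((E' + 1) * muf * Q), 1; split; first by rewrite !mulr_gt0// ltr_pwDr.
split=> //; move=> Theta Delta1 Bsc.
have EB : E' <= Bsc.
  have r3 : 1 <= Num.sqrt 3 :> R by rewrite -[X in X <= _]sqrtr1 ler_wsqrtr// ler1n.
  have T1 : Num.sqrt 3 * ((E' + 1) * muf * Q) / muf <= Theta.
    rewrite -[leLHS]mul1r /Theta ler_wpM2r ?le_max ?lexx//.
    by rewrite divr_ge0 ?(ltW hmuf)// !mulr_ge0 ?sqrtr_ge0 ?addr_ge0// ltW.
  have T2 : Num.sqrt 3 * ((E' + 1) * muf * Q) / muf = Num.sqrt 3 * (E' + 1) * Q.
    by field; rewrite gt_eqF.
  have T3 : (E' + 1) * Q <= Num.sqrt 3 * (E' + 1) * Q.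
    by rewrite -mulrA ler_peMl// mulr_ge0 ?addr_ge0// ltW.
  have T4 : 0 <= E' * Q by rewrite mulr_ge0// ltW.
  rewrite /Bsc le_max; apply/orP; right; rewrite ler_pdivlMr// -/Q.
  by move: T1; rewrite T2; lra.
(* The denominators differ by a shift of two: [w k.+1] carries [k + 1 + Gam], the claim the smaller
   [k + Gam - 1], which is positive because [k >= 1]. *)
have tail k (t : R) : (1 <= k)%N -> t <= E * w k.+1 ->
    t <= Bsc / (k%:R + Gam - 1) `^ (1 - a - b).
  move=> k1 /le_trans; apply; rewrite /w mulrA -/E' -/p.
  have k1' : 1 <= k%:R :> R by rewrite ler1n.
  have k0 : 0 < k%:R + Gam - 1 by lra.
  apply: ler_pM => //; first by rewrite invr_ge0 powR_ge0.
  rewrite lef_pV2 ?posrE ?powR_gt0//; apply: ge0_ler_powR.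
  - exact: ltW.
  - by rewrite nnegrE ltW.
  - by rewrite nnegrE ltW.
  - by rewrite sS /s; lra.
split.
- by move=> k k1; apply: tail => //; have [] := HE k.+1.
- by move=> k k1; apply: tail => //; have [] := HE k.+1.
- apply/cvg_enorm_dist.
  have w_lim : w k @[k --> \oo] --> (0 : R).
    apply/cvgrPdist_le => e e0; apply: filterS (small _ e0) => k [_ we _].
    by rewrite sub0r normrN gtr0_norm.
  (* Triangle inequality through the regularized solution: the averaged iterate follows the path
     within [E * w k], and the path tends to [xstar]. *)
  have H : E * w k + enorm (xl (lamk k) - xstar) @[k --> \oo] --> (0 : R).
    rewrite -[X in _ --> X](addr0 (0 : R)); apply: cvgD => //.
    by rewrite -[X in _ --> X](mulr0 E); exact: cvgMr.
  apply: (squeeze_cvgr _ (cvg_cst 0) H); near=> k; rewrite enorm_ge0/=.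
  rewrite -(subrKA (xl (lamk k))); apply: le_trans (enormD _ _) _.
  by rewrite lerD2r; have [] := HE k.
Unshelve. all: end_near. Qed.
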